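(* (In $\mathbf{ZF}$.) Let $\mathbf{X}$ be a first-countable Hausdorff space such that, for every $A\subseteq X$ and every $x\in\mathrm{cl}_{\mathbf{X}}(A)$, there exists a compact subset $K$ of $\mathbf{X}$ such that $x\in\mathrm{cl}_{\mathbf{X}}(A\cap K)$. Then $\mathbf{X}$ is Fréchet-Urysohn if and only if $\mathbf{CPCAC}(\mathbf{X})$ holds. If $\mathbf{X}$ is also a $\mathcal{K}$-Loeb regular space, then the following three statements are all equivalent: every subspace of $\mathbf{X}$ is a $k$-space; $\mathbf{X}$ is Fréchet-Urysohn; $\mathbf{CPCAC}(\mathbf{X})$.
   Context: The result is a theorem of $\mathbf{ZF}$ (Zermelo–Fraenkel set theory without the axiom of choice). $\mathrm{cl}_{\mathbf{X}}(A)$ is the closure of $A$ in $\mathbf{X}$. A set is denumerable if it is infinite and equipotent with a subset of $\omega$. For a set $K$, $\mathbf{PCAC}(K)$ is the statement: every denumerable family of non-empty subsets of $K$ has a partial choice function, i.e. some infinite subfamily of it has a choice function. $\mathbf{CPCAC}(\mathbf{X})$: for every infinite compact subset $K$ of $\mathbf{X}$, $\mathbf{PCAC}(K)$ holds. A topological space is $\mathcal{K}$-Loeb if the family of all its non-empty compact subsets has a choice function. A space $\mathbf{X}$ is a $k$-space if it is Hausdorff and every set $A\subseteq X$, such that $A\cap K$ is closed in $\mathbf{X}$ for every compact $K\subseteq X$, is closed in $\mathbf{X}$. A space $\mathbf{X}$ is Fréchet-Urysohn if, for every $A\subseteq X$ and every $x$ in the closure of $A$, there is a sequence of points of $A$ converging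 in $\mathbf{X}$ to $x$. *)

(* Defs.v *)
(* Choice is derivable from classical axioms commonly added to Rocq, so a
   statement about types and predicates would not express a theorem of ZF.
   Sets are therefore elements of an arbitrary model of first-order ZF; all
   mathematical notions below are relational formulas whose quantifiers range
   over the model only.  By soundness and completeness, a sentence holds in
   every model of ZF iff it is a theorem of ZF. *)

Set Implicit Arguments.
Unset Strict Implicit.

Record set_structure := SetStructure {
  carrier :> Type;
  mem : carrier -> carrier -> Prop
}.

Declare Scope zf_scope.
Delimit Scope zf_scope with zf.
Notation "x ∈ y" := (mem x y) (at level 70, no associativity) : zf_scope.
Open Scope zf_scope.

(* First-order formulas in the language {∈, =}, with de Bruijn indices. *)
Inductive formula : Type :=
| FMem (i j : nat)
| FEq (i j : nat)
| FFalse
| FImp (p q : formula)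
| FAnd (p q : formula)
| FOr (p q : formula)
| FAll (p : formula)
| FEx (p : formula).

Definition scons (M : Type) (x : M) (e : nat -> M) (n : nat) : M :=
  match n with O => x | S m => e m end.

Fixpoint sat (M : set_structure) (e : nat -> M) (p : formula) : Prop :=
  match p with
  | FMem i j => e i ∈ e j
  | FEq i j => e i = e j
  | FFalse => False
  | FImp p q => sat e p -> sat e q
  | FAnd p q => sat e p /\ sat e q
  | FOr p q => sat e p \/ sat e q
  | FAll p => forall x : M, sat (scons x e) p
  | FEx p => exists x : M, sat (scons x e) p
  end.

Definition subset (M : set_structure) (a b : M) : Prop :=
  forall z : M, z ∈ a -> z ∈ b.
Notation "a ⊆ b" := (subset a b) (at level 70, no associativity) : zf_scope.

Definition is_empty (M : set_structure) (a : M) : Prop :=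
  forall z : M, ~ z ∈ a.

Definition nonempty (M : set_structure) (a : M) : Prop :=
  exists z : M, z ∈ a.

Definition is_upair (M : set_structure) (p x y : M) : Prop :=
  forall z : M, z ∈ p <-> z = x \/ z = y.

Definition is_union (M : set_structure) (u a : M) : Prop :=
  forall z : M, z ∈ u <-> exists b : M, b ∈ a /\ z ∈ b.

Definition is_inter (M : set_structure) (c a b : M) : Prop :=
  forall z : M, z ∈ c <-> z ∈ a /\ z ∈ b.

Definition is_diff (M : set_structure) (c a b : M) : Prop :=
  forall z : M, z ∈ c <-> z ∈ a /\ ~ z ∈ b.

Definition is_succ (M : set_structure) (s n : M) : Prop :=
  forall z : M, z ∈ s <-> z ∈ n \/ z = n.

Definition inductive_set (M : set_structure) (I : M) : Prop :=
  (exists e : M, is_empty e /\ e ∈ I) /\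
  (forall n : M, n ∈ I -> exists s : M, is_succ s n /\ s ∈ I).

(* The schemas range over formulas, not over arbitrary predicates on M:
   instances for all predicates would make choice available inside M.
   Assignments e supply the parameters. *)
Record ZF (M : set_structure) : Prop := {
  zf_extensionality : forall a b : M, (forall z : M, z ∈ a <-> z ∈ b) -> a = b;
  zf_foundation : forall a : M, nonempty a ->
    exists b : M, b ∈ a /\ forall z : M, z ∈ b -> ~ z ∈ a;
  zf_pairing : forall x y : M, exists p : M, is_upair p x y;
  zf_union : forall a : M, exists u : M, is_union u a;
  zf_power_set : forall a : M, exists p : M, forall z : M, z ∈ p <-> z ⊆ a;
  zf_infinity : exists I : M, inductive_set I;
  zf_separation : forall (p : formula) (e : nat -> M) (a : M),
    exists b : M, forall x : M, x ∈ b <-> x ∈ a /\ sat (scons x e) p;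
  zf_replacement : forall (p : formula) (e : nat -> M) (a : M),
    (forall x y y' : M, x ∈ a ->
       sat (scons x (scons y e)) p -> sat (scons x (scons y' e)) p -> y = y') ->
    exists b : M, forall y : M,
      y ∈ b <-> exists x : M, x ∈ a /\ sat (scons x (scons y e)) p
}.

Definition is_omega (M : set_structure) (w : M) : Prop :=
  inductive_set w /\ forall I : M, inductive_set I -> w ⊆ I.

Definition is_opair (M : set_structure) (p x y : M) : Prop :=
  exists a b : M, is_upair a x x /\ is_upair b x y /\ is_upair p a b.

(* f(x) = y, when f is a function *)
Definition maps_to (M : set_structure) (f x y : M) : Prop :=
  exists p : M, is_opair p x y /\ p ∈ f.

Definition is_function (M : set_structure) (f A B : M) : Prop :=
  (forall p : M, p ∈ f ->
     exists x y : M, x ∈ A /\ y ∈ B /\ is_opair p x y) /\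
  (forall x : M, x ∈ A -> exists! y : M, maps_to f x y).

Definition is_bijection (M : set_structure) (f A B : M) : Prop :=
  is_function f A B /\
  (forall y : M, y ∈ B -> exists! x : M, maps_to f x y).

Definition equipotent (M : set_structure) (A B : M) : Prop :=
  exists f : M, is_bijection f A B.

Definition finite (M : set_structure) (A : M) : Prop :=
  exists w n : M, is_omega w /\ n ∈ w /\ equipotent A n.

Definition infinite (M : set_structure) (A : M) : Prop := ~ finite A.

Definition countable (M : set_structure) (A : M) : Prop :=
  exists w s : M, is_omega w /\ s ⊆ w /\ equipotent A s.

Definition denumerable (M : set_structure) (A : M) : Prop :=
  infinite A /\ countable A.

Definition is_choice_function (M : set_structure) (f F : M) : Prop :=
  (exists B : M, is_function f F B) /\
  (forall S c : M, maps_to f S c -> c ∈ S).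

Definition PCAC (M : set_structure) (K : M) : Prop :=
  forall F : M, denumerable F ->
    (forall S : M, S ∈ F -> S ⊆ K /\ nonempty S) ->
    exists G : M, G ⊆ F /\ infinite G /\ exists f : M, is_choice_function f G.

Definition is_topology (M : set_structure) (X tau : M) : Prop :=
  (forall U : M, U ∈ tau -> U ⊆ X) /\
  (forall E : M, is_empty E -> E ∈ tau) /\
  X ∈ tau /\
  (forall U V W : M, U ∈ tau -> V ∈ tau -> is_inter W U V -> W ∈ tau) /\
  (forall C W : M, C ⊆ tau -> is_union W C -> W ∈ tau).

Definition is_closed (M : set_structure) (X tau C : M) : Prop :=
  C ⊆ X /\ exists U : M, is_diff U X C /\ U ∈ tau.

(* x ∈ cl(A): x lies in every closed set that includes A. *)
Definition in_closure (M : set_structure) (X tau A x : M) : Prop :=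
  x ∈ X /\ forall C : M, is_closed X tau C -> A ⊆ C -> x ∈ C.

Definition covers (M : set_structure) (C K : M) : Prop :=
  forall x : M, x ∈ K -> exists U : M, U ∈ C /\ x ∈ U.

Definition is_compact (M : set_structure) (X tau K : M) : Prop :=
  K ⊆ X /\
  forall C : M, C ⊆ tau -> covers C K ->
    exists D : M, D ⊆ C /\ finite D /\ covers D K.

Definition disjoint (M : set_structure) (U V : M) : Prop :=
  forall z : M, ~ (z ∈ U /\ z ∈ V).

Definition Hausdorff (M : set_structure) (X tau : M) : Prop :=
  forall x y : M, x ∈ X -> y ∈ X -> x <> y ->
    exists U V : M, U ∈ tau /\ V ∈ tau /\ x ∈ U /\ y ∈ V /\ disjoint U V.

Definition regular (M : set_structure) (X tau : M) : Prop :=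
  forall x C : M, x ∈ X -> is_closed X tau C -> ~ x ∈ C ->
    exists U V : M, U ∈ tau /\ V ∈ tau /\ x ∈ U /\ C ⊆ V /\ disjoint U V.

Definition first_countable (M : set_structure) (X tau : M) : Prop :=
  forall x : M, x ∈ X ->
    exists B : M, countable B /\ B ⊆ tau /\ (forall U : M, U ∈ B -> x ∈ U) /\
      forall O : M, O ∈ tau -> x ∈ O -> exists U : M, U ∈ B /\ U ⊆ O.

(* On ω, n <= m is "n ∈ m or n = m". *)
Definition converges_to (M : set_structure) (tau w f x : M) : Prop :=
  forall U : M, U ∈ tau -> x ∈ U ->
    exists n : M, n ∈ w /\
      forall m y : M, m ∈ w -> n ∈ m \/ n = m -> maps_to f m y -> y ∈ U.

Definition Frechet_Urysohn (M : set_structure) (X tau : M) : Prop :=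
  forall A x : M, A ⊆ X -> in_closure X tau A x ->
    exists w f : M, is_omega w /\ is_function f w A /\ converges_to tau w f x.

Definition CPCAC (M : set_structure) (X tau : M) : Prop :=
  forall K : M, is_compact X tau K -> infinite K -> PCAC K.

Definition K_Loeb (M : set_structure) (X tau : M) : Prop :=
  exists F f : M,
    (forall K : M, K ∈ F <-> is_compact X tau K /\ nonempty K) /\
    is_choice_function f F.

Definition k_space (M : set_structure) (X tau : M) : Prop :=
  Hausdorff X tau /\
  forall A : M, A ⊆ X ->
    (forall K B : M, is_compact X tau K -> is_inter B A K ->
       is_closed X tau B) ->
    is_closed X tau A.

Definition is_subspace_topology (M : set_structure) (tau Y sigma : M) : Prop :=
  forall V : M, V ∈ sigma <-> exists U : M, U ∈ tau /\ is_inter V U Y.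

Definition every_subspace_is_k_space (M : set_structure) (X tau : M) : Prop :=
  forall Y sigma : M, Y ⊆ X -> is_subspace_topology tau Y sigma ->
    k_space Y sigma.

(* Main.v *)
Require Import Defs.
From Stdlib Require Import Classical Arith.

Set Implicit Arguments.
Unset Strict Implicit.

(** Separation and induction are available in the model only for first-order
    formulas, so every set formed below comes with a proof that the property
    defining it is [definable]; logical reasoning about the model is classical,
    and no choice of witnesses is made outside it.  The mathematical argument is as follows.
    At a point [x] of a first-countable space fix a decreasing base
    [V_0, V_1, ...] of open neighbourhoods.

    Partial choice gives sequences ([Frechet_Urysohn_of_CPCAC]).  If [x] is in
    the closure of [A] but not in [A], take [K] compact with [x] in the closure
    of [B], the trace of [A] on [K].  The sets [V_n ∩ B] form a denumerable
    family of non-empty subsets of [K]; a choice function on infinitely many of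
    them yields a sequence in [A] converging to [x].

    Sequences give partial choice ([CPCAC_of_Frechet_Urysohn]).  Given an
    infinite family [(S_i)] of non-empty subsets of a compact set, some point
    [x] is a cluster point of the tails ([compact_cluster_point]).  If [x] is in
    infinitely many [S_i], choose [x].  Otherwise, for each [n] take the first
    [S_i] with [i >= n] that omits [x] and meets [V_n], and let [C_n] be the set
    of the points of [S_i ∩ V_n] that leave the base of neighbourhoods earliest.
    Each [C_n] is non-empty and stays away from [x], while [x] is in the closure
    of their union.  A sequence in this union converging to [x] must visit [C_n]
    for arbitrarily large [n], hence infinitely many of the [S_i], and its first
    term in each set visited is a choice.

    Sequences make every subspace a k-space
    ([subspaces_k_of_Frechet_Urysohn]), since a convergent sequence with its
    limit is compact.  Conversely ([Frechet_Urysohn_of_subspaces_k]), if [x] is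
    in the closure of [A] but not in [A], the k-property of [A ∪ {x}] gives a
    compact [K ⊆ A ∪ {x}] with [x] in the closure of [A ∩ K].  For each [n] the
    set [(K ∩ cl V_n) \ V_m], with [m] least making it non-empty, is compact and
    included in [A]; the choice function on compact sets picks a point of it,
    and by regularity these points converge to [x].

    Where a textbook makes finitely many choices, [finite_bound] and
    [finite_collection] are used; both are proved by induction inside the
    model. *)

(** * Predicates definable with parameters *)

Section Definability.
Variable M : set_structure.

(** The value of a term, which is coded as either a variable or a parameter
    from the model. *)
Definition code_value (c : nat + M) (v : nat -> M) : M :=
  match c with inl i => v i | inr m => m end.

Definition is_term (t : (nat -> M) -> M) : Prop :=
  exists c, forall v, t v = code_value c v.

(** A predicate on assignments is definable when it is the satisfaction of one
    formula, each free index of which is filled with a variable or with a fixed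
    parameter. *)
Definition definable (P : (nat -> M) -> Prop) : Prop :=
  exists (p : formula) (r : nat -> nat + M),
    forall v, P v <-> sat (fun n => code_value (r n) v) p.

(** A renaming of the free indices, carried under one quantifier. *)
Definition lift_renaming (s : nat -> nat) (n : nat) : nat :=
  match n with O => O | S m => S (s m) end.

(** Renaming of the free indices of a formula. *)
Fixpoint rename (s : nat -> nat) (p : formula) : formula :=
  match p with
  | FMem i j => FMem (s i) (s j)
  | FEq i j => FEq (s i) (s j)
  | FFalse => FFalse
  | FImp p q => FImp (rename s p) (rename s q)
  | FAnd p q => FAnd (rename s p) (rename s q)
  | FOr p q => FOr (rename s p) (rename s q)
  | FAll p => FAll (rename (lift_renaming s) p)
  | FEx p => FEx (rename (lift_renaming s) p)
  end.

Lemma sat_ext (p : formula) : forall e e' : nat -> M,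
  (forall n, e n = e' n) -> (sat e p <-> sat e' p).
Proof.
  induction p; intros e e' He; simpl; rewrite ?He; try tauto.
  - now rewrite (IHp1 e e'), (IHp2 e e').
  - now rewrite (IHp1 e e'), (IHp2 e e').
  - now rewrite (IHp1 e e'), (IHp2 e e').
  - split; intros H x; [rewrite <- (IHp (scons x e)) | rewrite (IHp _ (scons x e'))];
      trivial; intros [|n]; simpl; auto.
  - split; intros [x H]; exists x;
      [rewrite <- (IHp (scons x e)) | rewrite (IHp _ (scons x e'))];
      trivial; intros [|n]; simpl; auto.
Qed.

Lemma sat_rename (p : formula) : forall (s : nat -> nat) (e : nat -> M),
  sat e (rename s p) <-> sat (fun n => e (s n)) p.
Proof.
  induction p; intros s e; simpl; try tauto.
  - now rewrite IHp1, IHp2.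
  - now rewrite IHp1, IHp2.
  - now rewrite IHp1, IHp2.
  - split; intros H x; specialize (H x); rewrite IHp in *;
      (eapply sat_ext; [|exact H]); intros [|n]; reflexivity.
  - split; intros [x H]; exists x; rewrite IHp in *;
      (eapply sat_ext; [|exact H]); intros [|n]; reflexivity.
Qed.

Lemma definable_ext (P Q : (nat -> M) -> Prop) :
  definable P -> (forall v, Q v <-> P v) -> definable Q.
Proof.
  intros (p & r & H) E. exists p, r. intro v. now rewrite E.
Qed.

Lemma definable_atom (mk : nat -> nat -> formula) (rel : M -> M -> Prop)
  (t u : (nat -> M) -> M) :
  (forall e i j, sat e (mk i j) <-> rel (e i) (e j)) ->
  is_term t -> is_term u -> definable (fun v => rel (t v) (u v)).
Proof.
  intros Hmk [c Hc] [d Hd].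
  exists (mk 0 1), (fun n => match n with O => c | _ => d end).
  intro v. now rewrite Hmk, Hc, Hd.
Qed.

Lemma definable_mem (t u : (nat -> M) -> M) :
  is_term t -> is_term u -> definable (fun v => mem (t v) (u v)).
Proof. now apply (@definable_atom FMem). Qed.

Lemma definable_eq (t u : (nat -> M) -> M) :
  is_term t -> is_term u -> definable (fun v => t v = u v).
Proof. now apply (@definable_atom FEq (@eq M)). Qed.

Lemma definable_False : definable (fun _ => False).
Proof. exists FFalse, (fun n => inl n). now intro v. Qed.

(** Two formulas are put over one parameter assignment by sending the indices
    of the first to even numbers and those of the second to odd ones. *)
Lemma definable_binary (mk : formula -> formula -> formula)
  (op : Prop -> Prop -> Prop) (P Q : (nat -> M) -> Prop) :
  (forall (e : nat -> M) p q, sat e (mk p q) <-> op (sat e p) (sat e q)) ->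
  (forall A A' B B', (A <-> A') -> (B <-> B') -> (op A B <-> op A' B')) ->
  definable P -> definable Q -> definable (fun v => op (P v) (Q v)).
Proof.
  intros Hmk Hop (p & r & Hp) (q & s & Hq).
  exists (mk (rename (fun n => 2 * n) p) (rename (fun n => S (2 * n)) q)).
  exists (fun n => if Nat.even n then r (Nat.div2 n) else s (Nat.div2 n)).
  intro v. rewrite Hmk. apply Hop.
  - rewrite sat_rename, Hp. apply sat_ext. intro n.
    now rewrite Nat.even_even, Nat.div2_double.
  - rewrite sat_rename, Hq. apply sat_ext. intro n.
    rewrite Nat.div2_succ_double, <- Nat.add_1_r, Nat.even_odd. reflexivity.
Qed.

Lemma definable_and (P Q : (nat -> M) -> Prop) :
  definable P -> definable Q -> definable (fun v => P v /\ Q v).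
Proof. apply (@definable_binary FAnd and); simpl; tauto. Qed.

Lemma definable_or (P Q : (nat -> M) -> Prop) :
  definable P -> definable Q -> definable (fun v => P v \/ Q v).
Proof. apply (@definable_binary FOr or); simpl; tauto. Qed.

Lemma definable_imp (P Q : (nat -> M) -> Prop) :
  definable P -> definable Q -> definable (fun v => P v -> Q v).
Proof. apply (@definable_binary FImp (fun A B => A -> B)); simpl; tauto. Qed.

(** Among the parameters and variables of the body, those sent to variable
    zero become the bound index, and all other indices are shifted past it. *)
Lemma definable_quantifier (mk : formula -> formula)
  (op : (M -> Prop) -> Prop) (R : (nat -> M) -> M -> Prop) :
  (forall (e : nat -> M) p, sat e (mk p) <-> op (fun x => sat (scons x e) p)) ->
  (forall A B : M -> Prop, (forall x, A x <-> B x) -> (op A <-> op B)) ->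
  definable (fun v => R (fun i => v (S i)) (v 0)) ->
  definable (fun v => op (fun x => R v x)).
Proof.
  intros Hmk Hop (p & r & Hp).
  exists (mk (rename (fun n => match r n with inl 0 => 0 | _ => S n end) p)).
  exists (fun n => match r n with inl (S i) => inl i | inl 0 => inl 0 | inr m => inr m end).
  intro v. rewrite Hmk. apply Hop. intro x.
  rewrite sat_rename.
  transitivity (sat (fun n => code_value (r n) (scons x v)) p).
  - rewrite <- Hp. reflexivity.
  - apply sat_ext. intro n. destruct (r n) as [[|i]|m] eqn:E; simpl; now rewrite ?E.
Qed.

Lemma definable_forall (R : (nat -> M) -> M -> Prop) :
  definable (fun v => R (fun i => v (S i)) (v 0)) ->
  definable (fun v => forall x, R v x).
Proof.
  apply (@definable_quantifier FAll (fun A => forall x, A x)); simpl; [tauto|].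
  firstorder.
Qed.

Lemma definable_exists (R : (nat -> M) -> M -> Prop) :
  definable (fun v => R (fun i => v (S i)) (v 0)) ->
  definable (fun v => exists x, R v x).
Proof.
  apply (@definable_quantifier FEx (fun A => exists x, A x)); simpl; [tauto|].
  firstorder.
Qed.

Lemma definable_subst (P : (nat -> M) -> Prop) (s : nat -> nat + M) :
  definable P -> definable (fun v => P (fun n => code_value (s n) v)).
Proof.
  intros (p & r & Hp).
  exists p, (fun n => match r n with inl i => s i | inr m => inr m end).
  intro v. rewrite Hp. apply sat_ext. intro n. now destruct (r n).
Qed.

Lemma definable_app1 (P : M -> Prop) (t : (nat -> M) -> M) :
  definable (fun v => P (v 0)) -> is_term t -> definable (fun v => P (t v)).
Proof.
  intros H [c Hc].
  apply (definable_ext (definable_subst (fun _ => c) H)).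
  intro v. now rewrite Hc.
Qed.

Lemma definable_app2 (R : M -> M -> Prop) (t u : (nat -> M) -> M) :
  definable (fun v => R (v 0) (v 1)) -> is_term t -> is_term u ->
  definable (fun v => R (t v) (u v)).
Proof.
  intros H [c Hc] [d Hd].
  apply (definable_ext
    (definable_subst (fun n => match n with O => c | _ => d end) H)).
  intro v. now rewrite Hc, Hd.
Qed.

End Definability.

(** Recognizes a variable or a parameter. *)
Ltac term_tac :=
  first [ eexists (inl _); intro; reflexivity
        | eexists (inr _); intro; reflexivity ].

Ltac definable_step :=
  lazymatch goal with
  | |- definable (fun v => mem (@?t v) (@?u v)) =>
      apply (@definable_mem _ t u); term_tac
  | |- definable (fun v => @eq _ (@?t v) (@?u v)) =>
      apply (@definable_eq _ t u); term_tac
  | |- definable (fun v => False) => apply definable_False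
  | |- definable (fun v => (@?P v) /\ (@?Q v)) => apply (@definable_and _ P Q)
  | |- definable (fun v => (@?P v) \/ (@?Q v)) => apply (@definable_or _ P Q)
  | |- definable (fun v => forall x : carrier _, @?R v x) =>
      apply (@definable_forall _ R); cbv beta
  | |- definable (fun v => exists x : carrier _, @?R v x) =>
      apply (@definable_exists _ R); cbv beta
  | |- definable (fun v => (@?P v) -> (@?Q v)) => apply (@definable_imp _ P Q)
  | H : definable (fun v => ?P (v 0)) |- definable (fun v => ?P (@?t v)) =>
      apply (@definable_app1 _ P t H); term_tac
  | H : definable (fun v => ?P (v 0) (v 1))
    |- definable (fun v => ?P (@?t v) (@?u v)) =>
      apply (@definable_app2 _ P t u H); term_tac
  end.

(** Proves definability of a predicate spelled out, up to unfolding, in the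
    language of set theory. *)
Ltac definability :=
  cbv beta delta [is_choice_function is_compact covers finite equipotent
    is_bijection is_function maps_to is_opair is_omega inductive_set is_succ
    is_diff is_inter is_union is_upair nonempty is_empty subset unique not iff];
  cbv beta;
  repeat definable_step.
(** * Sets, relations and natural numbers of the model *)

Section Toolkit.
Variable M : set_structure.
Hypothesis hZF : ZF M.

Lemma separation (P : M -> Prop) (a : M) :
  definable (fun v : nat -> M => P (v 0)) ->
  exists b : M, forall x, x ∈ b <-> x ∈ a /\ P x.
Proof.
  intros (p & r & Hp).
  destruct (zf_separation hZF
    (rename (fun n => match r n with inl _ => 0 | inr _ => S n end) p)
    (fun n => match r n with inl _ => a | inr m => m end) a) as [b Hb].
  exists b. intro x. rewrite Hb. apply and_iff_compat_l.
  rewrite sat_rename. symmetry.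
  transitivity (sat (fun n => code_value (r n) (fun _ => x)) p).
  - now rewrite <- Hp.
  - apply sat_ext. intro n. destruct (r n) eqn:E; simpl; now rewrite ?E.
Qed.

Lemma upair_exists (x y : M) : exists p, is_upair p x y.
Proof. apply (zf_pairing hZF). Qed.

Lemma opair_exists (x y : M) : exists p, is_opair p x y.
Proof.
  destruct (upair_exists x x) as [a Ha], (upair_exists x y) as [b Hb].
  destruct (upair_exists a b) as [p Hp]. now exists p, a, b.
Qed.

Lemma upair_unique (p q x y : M) : is_upair p x y -> is_upair q x y -> p = q.
Proof.
  intros Hp Hq. apply (zf_extensionality hZF). intro z. now rewrite (Hp z), (Hq z).
Qed.

Lemma opair_inj (p x y x' y' : M) :
  is_opair p x y -> is_opair p x' y' -> x = x' /\ y = y'.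
Proof.
  intros (a & b & Ha & Hb & Hp) (a' & b' & Ha' & Hb' & Hq).
  assert (Hx : x = x').
  { assert (H : a = a' \/ a = b') by (apply Hq, Hp; now left).
    destruct H as [-> | ->].
    - assert (H : x = x' \/ x = x') by (apply Ha', Ha; now left). tauto.
    - assert (H : x' = x \/ x' = x) by (apply Ha, Hb'; now left).
      destruct H; congruence. }
  subst x'. split; [trivial|].
  rewrite (upair_unique Ha' Ha) in *. clear Ha'.
  assert (H1 : b = a \/ b = b') by (apply Hq, Hp; now right).
  assert (H2 : b' = a \/ b' = b) by (apply Hp, Hq; now right).
  assert (E : b = b') by (destruct H1, H2; congruence).
  subst b'.
  assert (H3 : y = x \/ y = y') by (apply Hb', Hb; now right).
  assert (H4 : y' = x \/ y' = y) by (apply Hb, Hb'; now right).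
  destruct H3, H4; congruence.
Qed.

(** A definable relation between two sets is a set of ordered pairs. *)
Lemma relation_exists (R : M -> M -> Prop) (A B : M) :
  definable (fun v : nat -> M => R (v 0) (v 1)) ->
  exists E : M,
    (forall x y, maps_to E x y <-> x ∈ A /\ y ∈ B /\ R x y) /\
    forall p, p ∈ E -> exists x y, x ∈ A /\ y ∈ B /\ is_opair p x y.
Proof.
  intro HR.
  destruct (upair_exists A B) as [AB HAB].
  destruct (zf_union hZF AB) as [u Hu].
  destruct (zf_power_set hZF u) as [pu Hpu].
  destruct (zf_power_set hZF pu) as [ppu Hppu].
  destruct (separation (P := fun p => exists x y, x ∈ A /\ y ∈ B /\ R x y /\
    is_opair p x y) ppu) as [E HE]; [definability|].
  exists E. split.
  - intros x y. split.
    + intros (p & Hp & HpE). apply HE in HpE.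
      destruct HpE as (_ & x' & y' & Hx & Hy & Hxy & Hp').
      now destruct (opair_inj Hp Hp') as [-> ->].
    + intros (Hx & Hy & Hxy). destruct (opair_exists x y) as [p Hp].
      exists p. split; [trivial|]. apply HE. split.
      2: { exists x, y; auto. }
      destruct Hp as (a & b & Ha & Hb & Hp).
      apply Hppu. intros c Hc. apply Hpu. intros z Hz. apply Hu.
      assert (Hz' : z = x \/ z = y).
      { apply Hp in Hc. destruct Hc as [-> | ->].
        - apply Ha in Hz. tauto.
        - now apply Hb. }
      destruct Hz' as [-> | ->]; [exists A | exists B]; split; trivial;
        apply HAB; tauto.
  - intros p Hp. apply HE in Hp. destruct Hp as (_ & x & y & Hp).
    exists x, y. tauto.
Qed.

(** A definable, total and single-valued relation is a function of the model;
    replacement is not needed, as the target set is given. *)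
Lemma function_exists (R : M -> M -> Prop) (A B : M) :
  definable (fun v : nat -> M => R (v 0) (v 1)) ->
  (forall x, x ∈ A -> exists y, y ∈ B /\ R x y) ->
  (forall x y y', x ∈ A -> R x y -> R x y' -> y = y') ->
  exists f, is_function f A B /\ forall x y, maps_to f x y -> x ∈ A /\ R x y.
Proof.
  intros HR Htot Huniq.
  destruct (relation_exists A B HR) as (f & Hf & Hfp).
  exists f. split; [split|].
  - exact Hfp.
  - intros x Hx. destruct (Htot x Hx) as (y & Hy & Hxy).
    exists y. split.
    + now apply Hf.
    + intros y' Hy'. apply Hf in Hy'. apply (Huniq x); tauto.
  - intros x y Hxy. apply Hf in Hxy. tauto.
Qed.

Lemma function_total (f A B x : M) :
  is_function f A B -> x ∈ A -> exists y, maps_to f x y.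
Proof. intros [_ H] Hx. destruct (H x Hx) as (y & Hy & _). now exists y. Qed.

Lemma function_values (f A B x y : M) :
  is_function f A B -> maps_to f x y -> x ∈ A /\ y ∈ B.
Proof.
  intros [H _] (p & Hp & Hpf).
  destruct (H p Hpf) as (x' & y' & Hx & Hy & Hp').
  now destruct (opair_inj Hp Hp') as [-> ->].
Qed.

Lemma function_unique (f A B x y y' : M) :
  is_function f A B -> maps_to f x y -> maps_to f x y' -> y = y'.
Proof.
  intros Hf Hy Hy'. destruct (function_values Hf Hy) as [Hx _].
  destruct Hf as [_ H]. destruct (H x Hx) as (z & _ & Hz).
  rewrite <- (Hz y Hy). now apply Hz.
Qed.

Lemma bijection_injective (f A B x x' y : M) :
  is_bijection f A B -> maps_to f x y -> maps_to f x' y -> x = x'.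
Proof.
  intros [Hf H] Hx Hx'. destruct (function_values Hf Hx) as [_ Hy].
  destruct (H y Hy) as (z & _ & Hz).
  rewrite <- (Hz x Hx). now apply Hz.
Qed.

Lemma empty_unique (a b : M) : is_empty a -> is_empty b -> a = b.
Proof.
  intros Ha Hb. apply (zf_extensionality hZF). intro z.
  split; intro H; [now apply Ha in H | now apply Hb in H].
Qed.

Lemma empty_exists : exists e : M, is_empty e.
Proof. destruct (zf_infinity hZF) as [I [[e [He _]] _]]. now exists e. Qed.

Lemma succ_unique (s t n : M) : is_succ s n -> is_succ t n -> s = t.
Proof.
  intros Hs Ht. apply (zf_extensionality hZF). intro z. now rewrite (Hs z), (Ht z).
Qed.

Lemma insert_exists (D a : M) : exists B : M, forall z, z ∈ B <-> z ∈ D \/ z = a.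
Proof.
  destruct (upair_exists a a) as [d Hd]. destruct (upair_exists D d) as [p Hp].
  destruct (zf_union hZF p) as [B HB]. exists B. intro z. rewrite (HB z). split.
  - intros (c & Hc & Hz). apply Hp in Hc. destruct Hc as [-> | ->]; [now left|].
    right. apply Hd in Hz. tauto.
  - intros [Hz | ->].
    + exists D. split; [apply Hp; now left | trivial].
    + exists d. split; [apply Hp; now right | apply Hd; now left].
Qed.

Lemma succ_exists (n : M) : exists s, is_succ s n.
Proof. apply insert_exists. Qed.

Lemma omega_exists : exists w : M, is_omega w.
Proof.
  destruct (zf_infinity hZF) as [I HI].
  destruct (separation (P := fun x => forall J, inductive_set J -> x ∈ J) I)
    as [w Hw]; [definability|].
  exists w. split.
  - split.
    + destruct HI as [[e [He HeI]] _]. exists e. split; trivial.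
      apply Hw. split; trivial. intros J [[e' [He' HJ]] _].
      now rewrite (empty_unique He He').
    + intros n Hn. apply Hw in Hn. destruct Hn as [HnI Hn].
      destruct (proj2 HI n HnI) as (s & Hs & HsI).
      exists s. split; trivial. apply Hw. split; trivial.
      intros J HJ. destruct (proj2 HJ n (Hn J HJ)) as (t & Ht & HtJ).
      now rewrite (succ_unique Hs Ht).
  - intros J HJ x Hx. apply Hw in Hx. now apply Hx.
Qed.

Lemma omega_unique (w w' : M) : is_omega w -> is_omega w' -> w = w'.
Proof.
  intros [H1 H2] [H3 H4]. apply (zf_extensionality hZF). intro z.
  split; [apply (H2 _ H3) | apply (H4 _ H1)].
Qed.

Lemma mem_irrefl (x : M) : ~ x ∈ x.
Proof.
  intro Hx. destruct (upair_exists x x) as [a Ha].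
  destruct (zf_foundation hZF (a := a)) as (b & Hb & Hmin).
  - exists x. apply Ha. now left.
  - apply Ha in Hb. assert (b = x) by tauto. subst b.
    apply (Hmin x Hx). apply Ha. now left.
Qed.

Section Omega.
Variable w : M.
Hypothesis Hw : is_omega w.

Lemma zero_in_omega (e : M) : is_empty e -> e ∈ w.
Proof.
  intro He. destruct Hw as [[[e' [He' H]] _] _]. now rewrite (empty_unique He He').
Qed.

Lemma succ_in_omega (n s : M) : n ∈ w -> is_succ s n -> s ∈ w.
Proof.
  intros Hn Hs. destruct Hw as [[_ H] _]. destruct (H n Hn) as (t & Ht & HtJ).
  now rewrite (succ_unique Hs Ht).
Qed.

Lemma omega_induction (P : M -> Prop) :
  definable (fun v : nat -> M => P (v 0)) ->
  (forall e, is_empty e -> P e) ->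
  (forall n s, n ∈ w -> is_succ s n -> P n -> P s) ->
  forall n, n ∈ w -> P n.
Proof.
  intros HP H0 HS. destruct (separation w HP) as [J HJ].
  assert (Hind : inductive_set J).
  { split.
    - destruct empty_exists as [e He]. exists e. split; trivial.
      apply HJ. split; [now apply zero_in_omega | auto].
    - intros n Hn. apply HJ in Hn. destruct Hn as [Hn HPn].
      destruct (succ_exists n) as [s Hs]. exists s. split; trivial.
      apply HJ. split; [now apply (succ_in_omega Hn) | now apply (HS n)]. }
  intros n Hn. apply (proj2 Hw J Hind n) in Hn. apply HJ in Hn. tauto.
Qed.

(** The least number principle comes from foundation, without induction. *)
Lemma omega_least (P : M -> Prop) :
  definable (fun v : nat -> M => P (v 0)) ->
  (exists n, n ∈ w /\ P n) ->
  exists n, n ∈ w /\ P n /\ forall m, m ∈ w -> m ∈ n -> ~ P m.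
Proof.
  intros HP (n & Hn & HPn). destruct (separation w HP) as [J HJ].
  destruct (zf_foundation hZF (a := J)) as (b & Hb & Hmin).
  - exists n. now apply HJ.
  - exists b. apply HJ in Hb. split; [tauto|]. split; [tauto|].
    intros m Hm Hmb HPm. apply (Hmin m Hmb). now apply HJ.
Qed.

Lemma omega_transitive (n m : M) : n ∈ w -> m ∈ n -> m ∈ w.
Proof.
  intro Hn. revert m.
  apply (omega_induction (P := fun n => forall m, m ∈ n -> m ∈ w)); trivial.
  - definability.
  - intros e He m Hm. now apply He in Hm.
  - intros k s Hk Hs IH m Hm. apply Hs in Hm. destruct Hm as [Hm| ->]; auto.
Qed.

Lemma nat_transitive (n m k : M) : n ∈ w -> m ∈ n -> k ∈ m -> k ∈ n.
Proof.
  intro Hn. revert m k.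
  apply (omega_induction (P := fun n => forall m k, m ∈ n -> k ∈ m -> k ∈ n));
    trivial.
  - definability.
  - intros e He m k Hm. now apply He in Hm.
  - intros j s Hj Hs IH m k Hm Hk. apply Hs in Hm. apply Hs. left.
    destruct Hm as [Hm| ->]; eauto.
Qed.

Lemma succ_mono (n s m : M) : n ∈ w -> is_succ s n -> m ∈ n ->
  forall t, is_succ t m -> t ∈ s.
Proof.
  intro Hn. revert s m.
  apply (omega_induction (P := fun n => forall s m, is_succ s n -> m ∈ n ->
    forall t, is_succ t m -> t ∈ s)); trivial.
  - definability.
  - intros e He s m _ Hm. now apply He in Hm.
  - intros k s Hk Hs IH s' m Hs' Hm t Ht. apply Hs'.
    apply Hs in Hm. destruct Hm as [Hm| ->].
    + left. now apply (IH s m).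
    + right. apply (succ_unique Ht Hs).
Qed.

Lemma nat_trichotomy (n m : M) : n ∈ w -> m ∈ w -> m ∈ n \/ m = n \/ n ∈ m.
Proof.
  intro Hn. revert m.
  apply (omega_induction (P := fun n => forall m, m ∈ w -> m ∈ n \/ m = n \/ n ∈ m));
    trivial.
  - definability.
  - intros e He m Hm. right.
    apply (omega_induction (P := fun m => m = e \/ e ∈ m)); trivial.
    + definability.
    + intros e' He'. left. now apply empty_unique.
    + intros k s Hk Hs [-> | IH]; right; apply Hs; tauto.
  - intros k s Hk Hs IH m Hm. destruct (IH m Hm) as [H | [-> | H]].
    + left. apply Hs. now left.
    + left. apply Hs. now right.
    + right. destruct (succ_exists m) as [t Ht].
      assert (Hst : s ∈ t) by (apply (succ_mono Hm Ht H Hs)).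
      apply Ht in Hst. destruct Hst; auto.
Qed.

Lemma nat_not_mem (n m : M) : n ∈ w -> m ∈ w -> ~ m ∈ n -> n ∈ m \/ n = m.
Proof.
  intros Hn Hm H. destruct (nat_trichotomy Hn Hm) as [H1|[H1|H1]]; auto.
  contradiction.
Qed.

Lemma nat_upper_bound (n m : M) : n ∈ w -> m ∈ w ->
  exists k, k ∈ w /\ n ∈ k /\ m ∈ k.
Proof.
  intros Hn Hm.
  assert (H : exists j, j ∈ w /\ (n ∈ j \/ n = j) /\ (m ∈ j \/ m = j)).
  { destruct (nat_trichotomy Hn Hm) as [H | [-> | H]].
    - exists n; auto.
    - exists n; auto.
    - exists m; auto. }
  destruct H as (j & Hj & H1 & H2). destruct (succ_exists j) as [s Hs].
  exists s. split; [now apply (succ_in_omega Hj)|].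
  split; now apply Hs.
Qed.

(** ** Finite sets *)

Lemma empty_finite (A : M) : is_empty A -> finite A.
Proof.
  intro HA. exists w, A. split; [trivial|]. split; [now apply zero_in_omega|].
  exists A. split; [split|].
  - intros p Hp. now apply HA in Hp.
  - intros x Hx. now apply HA in Hx.
  - intros x Hx. now apply HA in Hx.
Qed.

Lemma finite_insert (A B a : M) :
  finite A -> (forall x, x ∈ B <-> x ∈ A \/ x = a) -> finite B.
Proof.
  intros (w' & k & Hw' & Hk & f & Hf) HB.
  rewrite (omega_unique Hw' Hw) in Hk. clear w' Hw'.
  destruct (classic (a ∈ A)) as [Ha|Ha].
  { assert (B = A) as ->.
    { apply (zf_extensionality hZF). intro z. rewrite HB.
      split; [intros [H| ->]; trivial | now left]. }
    exists w, k. split; [trivial|]. split; [trivial|]. now exists f. }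
  destruct (succ_exists k) as [s Hs].
  exists w, s. split; [trivial|]. split; [now apply (succ_in_omega Hk)|].
  pose (R := fun x y => maps_to f x y \/ (x = a /\ y = k)).
  assert (HRf : forall x y, maps_to f x y -> x ∈ A /\ y ∈ k)
    by (intros x y; apply (function_values (proj1 Hf))).
  destruct (@function_exists R B s) as (g & Hg & HgR).
  - unfold R. definability.
  - intros x Hx. apply HB in Hx. destruct Hx as [Hx | ->].
    + destruct (function_total (proj1 Hf) Hx) as [y Hy]. exists y.
      split; [apply Hs; left; now apply (HRf x) | now left].
    + exists k. split; [apply Hs; now right | now right].
  - intros x y y' Hx [H1|[-> ->]] [H2|[H2 ->]].
    + apply (function_unique (proj1 Hf) H1 H2).
    + subst x. now apply HRf in H1.
    + now apply HRf in H2.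
    + trivial.
  - exists g. split; [trivial|]. intros y Hy. apply Hs in Hy.
    assert (Hex : exists x, x ∈ B /\ R x y).
    { destruct Hy as [Hy| ->].
      - destruct (proj2 Hf y Hy) as (x & Hx & _). exists x.
        split; [apply HB; left; now apply (HRf x y) | now left].
      - exists a. split; [apply HB; now right | now right]. }
    destruct Hex as (x & HxB & Hxy). exists x.
    assert (Hinj : forall x x', R x y -> R x' y -> x = x').
    { intros x1 x2 [H1|[-> E1]] [H2|[-> E2]].
      - apply (bijection_injective Hf H1 H2).
      - subst y. apply HRf in H1. now apply proj2, mem_irrefl in H1.
      - subst y. apply HRf in H2. now apply proj2, mem_irrefl in H2.
      - trivial. }
    split.
    + destruct (function_total Hg HxB) as [y' Hy'].
      destruct (HgR x y' Hy') as [_ HR].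
      assert (y' = y) as <-; [|trivial].
      destruct HR as [H1|[-> ->]], Hxy as [H2|[H2 ->]]; trivial.
      * apply (function_unique (proj1 Hf) H1 H2).
      * subst x. now apply HRf in H1.
      * now apply HRf in H2.
    + intros x' Hx'. apply Hinj; [trivial | now apply HgR].
Qed.

(** Finite choice for bounds: a monotone family of conditions indexed by
    natural numbers, each element of a finite set satisfying one of them, has
    a member that all these elements satisfy. *)
Lemma finite_bound (A : M) (R : M -> M -> Prop) :
  finite A -> definable (fun v : nat -> M => R (v 0) (v 1)) ->
  (forall a n m, n ∈ w -> m ∈ w -> R a n -> n ∈ m -> R a m) ->
  (forall a, a ∈ A -> exists n, n ∈ w /\ R a n) ->
  exists N, N ∈ w /\ forall a, a ∈ A -> R a N.
Proof.
  intros (w' & k & Hw' & Hk & f & Hf) HR Hmono Hex.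
  rewrite (omega_unique Hw' Hw) in Hk. clear w' Hw'.
  assert (H : exists N, N ∈ w /\ forall a i, maps_to f a i -> i ∈ k -> R a N).
  { apply (omega_induction (P := fun j => exists N, N ∈ w /\
      forall a i, maps_to f a i -> i ∈ j -> R a N)); trivial.
    - definability.
    - intros e He. exists e. split; [now apply zero_in_omega|].
      intros a i _ Hi. now apply He in Hi.
    - intros j s Hj Hs (N & HN & IH).
      destruct (classic (exists a, maps_to f a j)) as [[a Ha]|Hno].
      + destruct (Hex a) as (n & Hn & Han).
        { apply (function_values (proj1 Hf) Ha). }
        destruct (nat_upper_bound HN Hn) as (K & HK & HNK & HnK).
        exists K. split; [trivial|]. intros b i Hbi Hi.
        apply Hs in Hi. destruct Hi as [Hi| ->].
        * apply (Hmono b N); auto. now apply (IH b i).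
        * rewrite (bijection_injective Hf Hbi Ha). now apply (Hmono a n).
      + exists N. split; [trivial|]. intros b i Hbi Hi.
        apply Hs in Hi. destruct Hi as [Hi| ->].
        * now apply (IH b i).
        * contradict Hno. now exists b. }
  destruct H as (N & HN & H). exists N. split; [trivial|].
  intros a Ha. destruct (function_total (proj1 Hf) Ha) as [i Hi].
  apply (H a i Hi). apply (function_values (proj1 Hf) Hi).
Qed.

(** A set is finite if a relation sends its elements, injectively but not
    necessarily with unique values, to numbers below a fixed one. *)
Lemma finite_of_injection (A N : M) (R : M -> M -> Prop) :
  N ∈ w -> definable (fun v : nat -> M => R (v 0) (v 1)) ->
  (forall a a' n, a ∈ A -> a' ∈ A -> R a n -> R a' n -> a = a') ->
  (forall a, a ∈ A -> exists n, n ∈ N /\ R a n) ->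
  finite A.
Proof.
  intros HN HR Hinj Hex.
  revert A Hinj Hex.
  apply (omega_induction (P := fun N => forall A,
    (forall a a' n, a ∈ A -> a' ∈ A -> R a n -> R a' n -> a = a') ->
    (forall a, a ∈ A -> exists n, n ∈ N /\ R a n) -> finite A)); trivial.
  - definability.
  - intros e He A _ Hex. apply empty_finite. intros a Ha.
    destruct (Hex a Ha) as (n & Hn & _). now apply He in Hn.
  - intros j s Hj Hs IH A Hinj Hex.
    destruct (classic (exists a, a ∈ A /\ R a j)) as [(a & Ha & Haj)|Hno].
    + destruct (separation (P := fun x => x <> a) A) as [A' HA']; [definability|].
      apply (@finite_insert A' A a).
      * apply IH.
        -- intros x x' n Hx Hx'. apply HA' in Hx, Hx'. apply Hinj; tauto.
        -- intros x Hx. apply HA' in Hx. destruct Hx as [Hx Hxa].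
           destruct (Hex x Hx) as (n & Hn & Hxn). apply Hs in Hn.
           destruct Hn as [Hn| ->]; [now exists n|].
           contradict Hxa. now apply (Hinj x a j).
      * intro x. rewrite HA'. split.
        -- intro Hx. destruct (classic (x = a)); tauto.
        -- intros [[Hx _]| ->]; trivial.
    + apply IH; trivial. intros x Hx. destruct (Hex x Hx) as (n & Hn & Hxn).
      apply Hs in Hn. destruct Hn as [Hn| ->]; [now exists n|].
      contradict Hno. now exists x.
Qed.

Lemma nat_finite (n : M) : n ∈ w -> finite n.
Proof.
  intro Hn. apply (finite_of_injection (R := fun a i => a = i) Hn).
  - definability.
  - congruence.
  - intros a Ha. now exists a.
Qed.

Lemma finite_subset (A B : M) : finite A -> B ⊆ A -> finite B.
Proof.
  intros (w' & k & Hw' & Hk & f & Hf) HB.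
  rewrite (omega_unique Hw' Hw) in Hk.
  apply (@finite_of_injection B k (fun x y => maps_to f x y)); trivial.
  - definability.
  - intros a a' n _ _ H1 H2. apply (bijection_injective Hf H1 H2).
  - intros a Ha. destruct (function_total (proj1 Hf) (HB a Ha)) as [y Hy].
    exists y. split; trivial. apply (function_values (proj1 Hf) Hy).
Qed.

(** Choice for finite families, in the form of a finite set of values. *)
Lemma finite_collection (A C : M) (R : M -> M -> Prop) :
  finite A -> definable (fun v : nat -> M => R (v 0) (v 1)) ->
  (forall a, a ∈ A -> exists b, b ∈ C /\ R a b) ->
  exists D, D ⊆ C /\ finite D /\ forall a, a ∈ A -> exists b, b ∈ D /\ R a b.
Proof.
  intros (w' & k & Hw' & Hk & f & Hf) HR Hex.
  rewrite (omega_unique Hw' Hw) in Hk. clear w' Hw'.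
  assert (H : exists D, D ⊆ C /\ finite D /\
    forall a i, maps_to f a i -> i ∈ k -> exists b, b ∈ D /\ R a b).
  { apply (omega_induction (P := fun j => exists D, D ⊆ C /\ finite D /\
      forall a i, maps_to f a i -> i ∈ j -> exists b, b ∈ D /\ R a b)); trivial.
    - definability.
    - intros e He. exists e. split; [|split].
      + intros z Hz. now apply He in Hz.
      + now apply empty_finite.
      + intros a i _ Hi. now apply He in Hi.
    - intros j s Hj Hs (D & HDC & HDf & IH).
      destruct (classic (exists a, maps_to f a j)) as [[a Ha]|Hno].
      + destruct (Hex a) as (b & Hb & Hab).
        { apply (function_values (proj1 Hf) Ha). }
        destruct (insert_exists D b) as [D' HD']. exists D'. split; [|split].
        * intros z Hz. apply HD' in Hz. destruct Hz as [Hz| ->]; auto.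
        * apply (finite_insert HDf HD').
        * intros a' i Hi Hij. apply Hs in Hij. destruct Hij as [Hij| ->].
          -- destruct (IH a' i Hi Hij) as (b' & Hb' & Hab'). exists b'.
             split; [apply HD'; now left|trivial].
          -- rewrite (bijection_injective Hf Hi Ha). exists b.
             split; [apply HD'; now right|trivial].
      + exists D. split; [trivial|]. split; [trivial|].
        intros a i Hi Hij. apply Hs in Hij. destruct Hij as [Hij| ->].
        * now apply (IH a i).
        * contradict Hno. now exists a. }
  destruct H as (D & HDC & HDf & H). exists D. split; [trivial|]. split; [trivial|].
  intros a Ha. destruct (function_total (proj1 Hf) Ha) as [i Hi].
  apply (H a i Hi). apply (function_values (proj1 Hf) Hi).
Qed.

Lemma countable_of_injection (A : M) (R : M -> M -> Prop) :
  definable (fun v : nat -> M => R (v 0) (v 1)) ->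
  (forall a a' n, a ∈ A -> a' ∈ A -> R a n -> R a' n -> a = a') ->
  (forall a n n', a ∈ A -> R a n -> R a n' -> n = n') ->
  (forall a, a ∈ A -> exists n, n ∈ w /\ R a n) ->
  countable A.
Proof.
  intros HR Hinj Hfun Hex.
  destruct (separation (P := fun n => exists a, a ∈ A /\ R a n) w) as [s Hs];
    [definability|].
  exists w, s. split; [trivial|]. split; [intros n Hn; now apply Hs in Hn|].
  destruct (@function_exists R A s) as (f & Hf & HfR).
  - trivial.
  - intros a Ha. destruct (Hex a Ha) as (n & Hn & Han). exists n.
    split; trivial. apply Hs. split; trivial. now exists a.
  - trivial.
  - exists f. split; [trivial|]. intros n Hn. apply Hs in Hn.
    destruct Hn as (Hn & a & Ha & Han). exists a. split.
    + destruct (function_total Hf Ha) as [n' Hn'].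
      assert (n = n') as ->; [|trivial].
      apply (Hfun a); trivial. now apply HfR.
    + intros a' Ha'. apply HfR in Ha'. apply (Hinj a a' n); tauto.
Qed.

(** A numbering of a countable set by elements of the given [w]. *)
Lemma countable_numbering (A : M) : countable A ->
  exists h, (forall a, a ∈ A -> exists n, n ∈ w /\ maps_to h a n) /\
    (forall a n, maps_to h a n -> a ∈ A /\ n ∈ w) /\
    (forall a a' n, maps_to h a n -> maps_to h a' n -> a = a') /\
    (forall a n n', maps_to h a n -> maps_to h a n' -> n = n').
Proof.
  intros (w' & s & Hw' & Hs & h & Hh). rewrite (omega_unique Hw' Hw) in Hs.
  assert (Hv : forall a n, maps_to h a n -> a ∈ A /\ n ∈ w).
  { intros a n H. apply (function_values (proj1 Hh)) in H. destruct H; auto. }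
  exists h. split; [|split; [|split]]; trivial.
  - intros a Ha. destruct (function_total (proj1 Hh) Ha) as [n Hn].
    exists n. split; [|trivial]. now apply (Hv a).
  - intros a a' n. apply (bijection_injective Hh).
  - intros a n n'. apply (function_unique (proj1 Hh)).
Qed.

End Omega.
End Toolkit.

(** * First-countable spaces in the model *)

Section Spaces.
Variable M : set_structure.
Hypothesis hZF : ZF M.
Variables X tau w : M.
Hypothesis htop : is_topology X tau.
Hypothesis Hw : is_omega w.

Lemma open_subset (U z : M) : U ∈ tau -> z ∈ U -> z ∈ X.
Proof. intros HU. now apply (proj1 htop). Qed.

Lemma open_inter (U V : M) : U ∈ tau -> V ∈ tau ->
  exists W, W ∈ tau /\ forall z, z ∈ W <-> z ∈ U /\ z ∈ V.
Proof.
  intros HU HV.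
  destruct (separation hZF (P := fun z => z ∈ V) U) as [W HW]; [definability|].
  exists W. split; [|trivial].
  destruct htop as (_ & _ & _ & H & _). now apply (H U V W).
Qed.

(** The union of the open subsets of a set is formed without choosing a
    neighbourhood for each point. *)
Lemma open_of_local (W : M) :
  (forall z, z ∈ W -> exists O, O ∈ tau /\ z ∈ O /\ O ⊆ W) -> W ∈ tau.
Proof.
  intro H.
  destruct (separation hZF (P := fun O => O ⊆ W) tau) as [C HC]; [definability|].
  destruct htop as (_ & _ & _ & _ & Hun). apply (Hun C W).
  - intros O HO. apply HC in HO. tauto.
  - intro z. split.
    + intro Hz. destruct (H z Hz) as (O & HO & HzO & HOW).
      exists O. split; [now apply HC|trivial].
    + intros (O & HO & HzO). apply HC in HO. now apply (proj2 HO).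
Qed.

Lemma diff_exists (A B : M) : exists C, is_diff C A B.
Proof. apply (separation hZF (P := fun z => ~ z ∈ B)). definability. Qed.

Lemma closure_meets (A x U : M) : A ⊆ X -> in_closure X tau A x ->
  U ∈ tau -> x ∈ U -> exists y, y ∈ U /\ y ∈ A.
Proof.
  intros HA [Hx Hcl] HU HxU. apply NNPP. intro Hno.
  destruct (diff_exists X U) as [C HC].
  assert (HxC : x ∈ C).
  { apply Hcl.
    - split; [intros z Hz; now apply HC in Hz|]. exists U. split; [|trivial].
      intro z. rewrite (HC z). split.
      + intro Hz. split; [now apply (open_subset HU)|tauto].
      + intros [Hz H]. apply NNPP. tauto.
    - intros z Hz. apply HC. split; [auto|]. intro H. apply Hno. now exists z. }
  now apply HC in HxC.
Qed.

Lemma in_closure_intro (A x : M) : x ∈ X ->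
  (forall U, U ∈ tau -> x ∈ U -> exists y, y ∈ U /\ y ∈ A) -> in_closure X tau A x.
Proof.
  intros Hx H. split; [trivial|]. intros C [HC (U & HU & HUt)] HAC.
  apply NNPP. intro HxC.
  destruct (H U HUt) as (y & HyU & HyA); [now apply HU|].
  apply HU in HyU. apply (proj2 HyU). auto.
Qed.

(** A decreasing countable base of open neighbourhoods of [x], encoded by one
    relation [E] on the natural numbers and [X]: the points related to [n] form
    the [n]-th neighbourhood. *)
Definition local_base (x E : M) : Prop :=
  (forall n, n ∈ w -> exists U, U ∈ tau /\ forall y, y ∈ U <-> maps_to E n y) /\
  (forall n, n ∈ w -> maps_to E n x) /\
  (forall n m y, n ∈ w -> m ∈ w -> n ∈ m -> maps_to E m y -> maps_to E n y) /\
  (forall O, O ∈ tau -> x ∈ O ->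
     exists n, n ∈ w /\ forall y, maps_to E n y -> y ∈ O).

Lemma local_base_exists (x : M) : first_countable X tau -> x ∈ X ->
  exists E, local_base x E.
Proof.
  intros hfc Hx. destruct (hfc x Hx) as (B & HBc & HBt & HBx & HBb).
  destruct (countable_numbering hZF Hw HBc) as (h & Hh1 & Hh2 & Hh3 & Hh4).
  (* The n-th neighbourhood is the intersection of the members of the base
     numbered below n; it is all of X when n is zero. *)
  pose (R := fun n y => forall U i, maps_to h U i -> i ∈ n -> y ∈ U).
  destruct (@relation_exists _ hZF R w X) as (E & HE & _);
    [unfold R; definability|].
  exists E. split; [|split; [|split]].
  - apply (omega_induction hZF Hw (P := fun n => exists U, U ∈ tau /\
      forall y, y ∈ U <-> maps_to E n y)); [definability| |].
    + intros e He. exists X. split; [apply htop|]. intro y. rewrite HE. split.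
      * intro Hy. split; [now apply (zero_in_omega hZF Hw)|]. split; [trivial|].
        intros U i _ Hi. now apply He in Hi.
      * tauto.
    + intros n s Hn Hs (U & HU & HUE).
      assert (Hsw : s ∈ w) by now apply (succ_in_omega hZF Hw Hn).
      destruct (classic (exists V, maps_to h V n)) as [[V HV]|Hno].
      * destruct (@open_inter U V) as (W & HW & HWz); trivial.
        { apply HBt. now apply (Hh2 V n). }
        exists W. split; [trivial|]. intro y.
        rewrite HWz, HUE, !HE. split.
        -- intros ((_ & Hy & HR) & HyV). split; [trivial|]. split; [trivial|].
           intros U' i HU' Hi. apply Hs in Hi. destruct Hi as [Hi| ->].
           ++ now apply (HR U' i).
           ++ now rewrite (Hh3 U' V n HU' HV).
        -- intros (_ & Hy & HR). split.
           ++ split; [trivial|]. split; [trivial|].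
              intros U' i HU' Hi. apply (HR U' i); trivial. apply Hs. now left.
           ++ apply (HR V n); trivial. apply Hs. now right.
      * exists U. split; [trivial|]. intro y. rewrite HUE, !HE. split.
        -- intros (_ & Hy & HR). split; [trivial|]. split; [trivial|].
           intros U' i HU' Hi. apply Hs in Hi. destruct Hi as [Hi| ->].
           ++ now apply (HR U' i).
           ++ contradict Hno. now exists U'.
        -- intros (_ & Hy & HR). split; [trivial|]. split; [trivial|].
           intros U' i HU' Hi. apply (HR U' i); trivial. apply Hs. now left.
  - intros n Hn. apply HE. split; [trivial|]. split; [trivial|].
    intros U i HU _. apply HBx. now apply (Hh2 U i).
  - intros n m y Hn Hm Hnm Hy. apply HE in Hy. apply HE.
    destruct Hy as (_ & Hy & HR). split; [trivial|]. split; [trivial|].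
    intros U i HU Hi. apply (HR U i HU). apply (nat_transitive hZF Hw Hm Hnm Hi).
  - intros O HO HxO. destruct (HBb O HO HxO) as (U & HU & HUO).
    destruct (Hh1 U HU) as (i & Hi & HUi). destruct (succ_exists hZF i) as [s Hs].
    exists s. split; [now apply (succ_in_omega hZF Hw Hi)|].
    intros y Hy. apply HE in Hy. apply HUO. apply (proj2 (proj2 Hy) U i HUi).
    apply Hs. now right.
Qed.

Lemma local_base_le (x E n m y : M) : local_base x E -> n ∈ w -> m ∈ w ->
  n ∈ m \/ n = m -> maps_to E m y -> maps_to E n y.
Proof.
  intros (_ & _ & H & _) Hn Hm [Hnm| ->]; [now apply H|trivial].
Qed.

Lemma local_base_separates (x E y : M) : Hausdorff X tau -> local_base x E ->
  x ∈ X -> y ∈ X -> x <> y -> exists n, n ∈ w /\ ~ maps_to E n y.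
Proof.
  intros hT2 (_ & _ & _ & HE) Hx Hy Hxy.
  destruct (hT2 x y Hx Hy Hxy) as (U & V & HU & HV & HxU & HyV & Hdis).
  destruct (HE U HU HxU) as (n & Hn & HnU). exists n. split; [trivial|].
  intro H. apply (Hdis y). auto.
Qed.

Lemma closure_meets_base (A x E n : M) : A ⊆ X -> in_closure X tau A x ->
  local_base x E -> n ∈ w -> exists y, maps_to E n y /\ y ∈ A.
Proof.
  intros HA Hcl (HEo & HEx & _) Hn. destruct (HEo n Hn) as (U & HU & HUE).
  destruct (@closure_meets A x U) as (y & Hy & HyA); trivial.
  - apply HUE. auto.
  - exists y. split; [now apply HUE|trivial].
Qed.

(** In a first-countable Hausdorff space no choice is needed to separate a
    point from a compact set: a finite family of open sets each disjoint from
    some basic neighbourhood of the point is disjoint from a common one. *)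
Lemma compact_separation (K y : M) : first_countable X tau -> Hausdorff X tau ->
  is_compact X tau K -> y ∈ X -> ~ y ∈ K ->
  exists O, O ∈ tau /\ y ∈ O /\ forall z, z ∈ O -> ~ z ∈ K.
Proof.
  intros hfc hT2 [HKX HK] Hy HyK.
  destruct (local_base_exists hfc Hy) as [E HE].
  pose (R := fun U n => forall z, maps_to E n z -> ~ z ∈ U).
  assert (HR : definable (fun v : nat -> M => R (v 0) (v 1)))
    by (unfold R; definability).
  destruct (separation hZF (P := fun U => exists n, n ∈ w /\ R U n) tau)
    as [C HC]; [definability|].
  destruct (HK C) as (D & HDC & HDf & HDK).
  - intros U HU. now apply HC in HU.
  - intros x Hx. destruct (hT2 y x) as (V & U & HV & HU & HyV & HxU & Hdis).
    + trivial.
    + auto.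
    + intros ->. contradiction.
    + exists U. split; [|trivial]. apply HC. split; [trivial|].
      destruct HE as (_ & _ & _ & HE). destruct (HE V HV HyV) as (n & Hn & HnV).
      exists n. split; [trivial|]. intros z Hz HzU. apply (Hdis z). auto.
  - destruct (finite_bound hZF Hw HDf HR) as (N & HN & HDN).
    + intros U n m Hn Hm HRn Hnm z Hz. apply HRn.
      apply (local_base_le HE Hn Hm); auto.
    + intros U HU. apply HDC in HU. now apply HC in HU.
    + destruct HE as (HEo & HEx & _). destruct (HEo N HN) as (O & HO & HON).
      exists O. split; [trivial|]. split; [apply HON; auto|].
      intros z Hz HzK. destruct (HDK z HzK) as (U & HU & HzU).
      apply (HDN U HU z); trivial. now apply HON.
Qed.

Lemma compact_of_relatively_closed (K L : M) : is_compact X tau K -> L ⊆ K ->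
  (forall z, z ∈ K -> ~ z ∈ L ->
     exists O, O ∈ tau /\ z ∈ O /\ forall y, y ∈ O -> ~ y ∈ L) ->
  is_compact X tau L.
Proof.
  intros [HKX HK] HLK Hcl. split; [intros z Hz; auto|].
  intros C HC HCL.
  destruct (separation hZF (P := fun U => U ∈ C \/ forall y, y ∈ U -> ~ y ∈ L) tau)
    as [C' HC']; [definability|].
  destruct (HK C') as (D & HDC & HDf & HDK).
  - intros U HU. now apply HC' in HU.
  - intros z Hz. destruct (classic (z ∈ L)) as [HzL|HzL].
    + destruct (HCL z HzL) as (U & HU & HzU). exists U. split; [|trivial].
      apply HC'. auto.
    + destruct (Hcl z Hz HzL) as (O & HO & HzO & HOL). exists O.
      split; [|trivial]. apply HC'. auto.
  - destruct (separation hZF (P := fun U => U ∈ C) D) as [D' HD']; [definability|].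
    exists D'. split; [intros U HU; now apply HD' in HU|]. split.
    + apply (finite_subset hZF Hw HDf). intros U HU. now apply HD' in HU.
    + intros z Hz. destruct (HDK z (HLK z Hz)) as (U & HU & HzU).
      exists U. split; [|trivial]. apply HD'. split; [trivial|].
      apply HDC in HU. apply HC' in HU. destruct HU as [_ [HU|HU]]; [trivial|].
      now apply HU in HzU.
Qed.

(** * Partial choice on compact sets gives convergent sequences *)

Lemma constant_sequence (A x : M) : x ∈ A ->
  exists f, is_function f w A /\ converges_to tau w f x.
Proof.
  intro Hx.
  destruct (@function_exists _ hZF (fun n y => y = x) w A) as (f & Hf & Hfx).
  - definability.
  - intros n _. now exists x.
  - congruence.
  - exists f. split; [trivial|]. intros U HU HxU.
    destruct (empty_exists hZF) as [e He]. exists e.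
    split; [now apply (zero_in_omega hZF Hw)|].
    intros m y _ _ Hy. apply Hfx in Hy. now destruct Hy as [_ ->].
Qed.

Lemma Frechet_Urysohn_of_CPCAC :
  first_countable X tau -> Hausdorff X tau ->
  (forall A x : M, subset A X -> in_closure X tau A x ->
     exists K B : M,
       is_compact X tau K /\ is_inter B A K /\ in_closure X tau B x) ->
  CPCAC X tau -> Frechet_Urysohn X tau.
Proof.
  intros hfc hT2 hcl hC A x HA HxA. exists w.
  cut (exists f, is_function f w A /\ converges_to tau w f x).
  { intros [f Hf]. now exists f. }
  destruct (classic (x ∈ A)) as [Hx|Hx]; [now apply constant_sequence|].
  destruct (hcl A x HA HxA) as (K & B & HK & HB & HxB).
  assert (HxX : x ∈ X) by exact (proj1 HxA).
  assert (HBX : B ⊆ X) by (intros z Hz; apply HB in Hz; apply HA; tauto).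
  destruct (local_base_exists hfc HxX) as [E HE].
  assert (Hsep : forall y, y ∈ B -> exists n, n ∈ w /\ ~ maps_to E n y).
  { intros y Hy. apply (local_base_separates hT2 HE); auto.
    intros ->. apply HB in Hy. tauto. }
  assert (Hmeet : forall n, n ∈ w -> exists y, maps_to E n y /\ y ∈ B).
  { intros n Hn. now apply (closure_meets_base HBX HxB HE). }
  (* T S n says that S is the trace on B of the n-th neighbourhood of x. *)
  pose (T := fun S n => forall y, y ∈ S <-> y ∈ B /\ maps_to E n y).
  assert (HT : definable (fun v : nat -> M => T (v 0) (v 1)))
    by (unfold T; definability).
  assert (HTinj : forall S S' n, T S n -> T S' n -> S = S').
  { intros S S' n H H'. apply (zf_extensionality hZF). intro z.
    now rewrite (H z), (H' z). }
  destruct (zf_power_set hZF K) as [PK HPK].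
  destruct (separation hZF (P := fun S => exists n, n ∈ w /\ T S n) PK) as [F HF];
    [definability|].
  assert (HFi : infinite F).
  { intro Hfin.
    destruct (@finite_bound _ hZF w Hw F (fun S n => exists m, m ∈ w /\ m ∈ n /\ T S m))
      as (N & HN & HNF); trivial.
    - definability.
    - intros S n m Hn Hm (k & Hk & Hkn & HkS) Hnm. exists k.
      split; [trivial|]. split; [|trivial].
      apply (nat_transitive hZF Hw Hm Hnm Hkn).
    - intros S HS. apply HF in HS. destruct HS as (_ & n & Hn & HS).
      destruct (succ_exists hZF n) as [s Hs]. exists s.
      split; [now apply (succ_in_omega hZF Hw Hn)|]. exists n.
      split; [trivial|]. split; [apply Hs; now right|trivial].
    - destruct (Hmeet N HN) as (y & HyN & HyB).
      destruct (Hsep y HyB) as (j & Hj & Hyj).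
      destruct (separation hZF (P := fun y => maps_to E j y) B) as [S HS];
        [definability|].
      destruct (HNF S) as (m & Hm & HmN & HSm).
      + apply HF. split; [|now exists j]. apply HPK. intros z Hz.
        apply HS in Hz. apply HB. tauto.
      + apply Hyj. apply HS. apply HSm. split; [trivial|].
        apply (local_base_le HE Hm HN); auto. }
  (* L S n says that n is the least index at which S occurs. *)
  pose (L := fun S n => n ∈ w /\ T S n /\ forall m, m ∈ n -> ~ T S m).
  assert (HL : definable (fun v : nat -> M => L (v 0) (v 1)))
    by (unfold L; definability).
  assert (HLfun : forall S n n', L S n -> L S n' -> n = n').
  { intros S n n' (Hn & HSn & Hmin) (Hn' & HSn' & Hmin').
    destruct (nat_trichotomy hZF Hw Hn Hn') as [H|[H|H]]; [|now symmetry|].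
    - now apply Hmin in H.
    - now apply Hmin' in H. }
  assert (HLex : forall S, S ∈ F -> exists n, n ∈ w /\ L S n).
  { intros S HS. apply HF in HS. destruct HS as [_ HS].
    destruct (omega_least hZF (w := w) (P := fun n => T S n))
      as (n & Hn & HSn & Hmin); [definability|trivial|].
    exists n. split; [trivial|]. split; [trivial|]. split; [trivial|].
    intros m Hm. apply Hmin; trivial. apply (omega_transitive hZF Hw Hn Hm). }
  assert (HLinj : forall S S' n, L S n -> L S' n -> S = S').
  { intros S S' n (_ & H & _) (_ & H' & _). now apply (HTinj S S' n). }
  assert (HFc : countable F).
  { apply (countable_of_injection hZF Hw HL); trivial; eauto. }
  assert (HKi : infinite K).
  { intro Hfin.
    destruct (@finite_bound _ hZF w Hw K (fun y n => y ∈ B -> ~ maps_to E n y))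
      as (N & HN & HNK); trivial.
    - definability.
    - intros y n m Hn Hm Hyn Hnm HyB Hy. apply (Hyn HyB).
      apply (local_base_le HE Hn Hm); auto.
    - intros y _. destruct (classic (y ∈ B)) as [HyB|HyB].
      + destruct (Hsep y HyB) as (n & Hn & Hyn). now exists n.
      + destruct (empty_exists hZF) as [e He]. exists e.
        split; [now apply (zero_in_omega hZF Hw)|tauto].
    - destruct (Hmeet N HN) as (y & HyN & HyB). apply (HNK y); trivial.
      now apply HB in HyB. }
  destruct (hC K HK HKi F) as (G & HGF & HGi & c & (Cod & Hc) & Hcin).
  { now split. }
  { intros S HS. apply HF in HS. destruct HS as (HSK & n & Hn & HSn).
    split; [now apply HPK|]. destruct (Hmeet n Hn) as (y & Hyn & HyB).
    exists y. now apply HSn. }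
  (* P n k says that k is the smallest number not below n at which L numbers a
     member of G. *)
  pose (P0 := fun n k => k ∈ w /\ ~ k ∈ n /\ exists S, S ∈ G /\ L S k).
  pose (P := fun n k => P0 n k /\ forall m, m ∈ k -> ~ P0 n m).
  assert (HPex : forall n, n ∈ w -> exists k, P n k).
  { intros n Hn.
    destruct (omega_least hZF (w := w) (P := fun k => P0 n k))
      as (k & Hk & HP & Hmin).
    - unfold P0, L, T. definability.
    - apply NNPP. intro Hno. apply HGi.
      apply (finite_of_injection hZF Hw Hn HL).
      + intros S S' m _ _. apply HLinj.
      + intros S HS. destruct (HLex S (HGF S HS)) as (k & Hk & HSk).
        exists k. split; [|trivial]. apply NNPP. intro Hkn. apply Hno.
        exists k. split; [trivial|]. split; [trivial|]. split; [trivial|].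
        now exists S.
    - exists k. split; [trivial|]. intros m Hm. apply Hmin; trivial.
      apply (omega_transitive hZF Hw Hk Hm). }
  assert (HPfun : forall n k k', P n k -> P n k' -> k = k').
  { intros n k k' [H Hmin] [H' Hmin'].
    destruct (nat_trichotomy hZF Hw (proj1 H) (proj1 H')) as [H1|[H1|H1]];
      [|now symmetry|].
    - now apply Hmin in H1.
    - now apply Hmin' in H1. }
  destruct (@function_exists _ hZF
    (fun n y => exists k S, P n k /\ S ∈ G /\ L S k /\ maps_to c S y) w A)
    as (f & Hf & HfR).
  - unfold P, P0, L, T. definability.
  - intros n Hn. destruct (HPex n Hn) as [k Hk].
    destruct (proj2 (proj2 (proj1 Hk))) as (S & HS & HSk).
    destruct (function_total Hc HS) as [y Hy].
    exists y. split; [|now exists k, S].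
    assert (HyB : y ∈ B) by (apply HSk; now apply Hcin).
    now apply HB in HyB.
  - intros n y y' _ (k & S & Hk & HS & HSk & Hy) (k' & S' & Hk' & HS' & HSk' & Hy').
    rewrite (HPfun n k' k Hk' Hk) in HSk'.
    rewrite (HLinj S' S k HSk' HSk) in Hy'.
    apply (function_unique hZF Hc Hy Hy').
  - exists f. split; [trivial|]. intros U HU HxU.
    destruct (proj2 (proj2 (proj2 HE)) U HU HxU) as (n & Hn & HnU).
    exists n. split; [trivial|]. intros m y Hm Hnm Hy. apply HnU.
    apply HfR in Hy.
    destruct Hy as (_ & k & S & ((Hk & Hkm & _) & _) & HS & HSk & Hy).
    apply (local_base_le HE Hn Hm Hnm).
    apply (local_base_le HE Hm Hk); [now apply (nat_not_mem hZF Hw)|].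
    apply Hcin in Hy. apply (proj1 (proj2 HSk)) in Hy. tauto.
Qed.

(** * Convergent sequences give partial choice on compact sets *)

(** A compact set that includes the members of a family of non-empty sets, with
    unbounded numbering [h], has a point every neighbourhood of which meets
    members of arbitrarily large number. *)
Lemma compact_cluster_point (K F h : M) : is_compact X tau K ->
  (forall S, S ∈ F -> S ⊆ K /\ nonempty S) ->
  (forall n, n ∈ w -> exists S i, S ∈ F /\ maps_to h S i /\ ~ i ∈ n) ->
  exists x, x ∈ K /\ forall n U, n ∈ w -> U ∈ tau -> x ∈ U ->
    exists y S i, y ∈ U /\ y ∈ S /\ S ∈ F /\ maps_to h S i /\ ~ i ∈ n.
Proof.
  intros [HKX HK] HF Hunb. apply NNPP. intro Hno.
  pose (R := fun U n => forall y S i, y ∈ U -> y ∈ S -> S ∈ F -> maps_to h S i -> i ∈ n).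
  assert (HR : definable (fun v : nat -> M => R (v 0) (v 1)))
    by (unfold R; definability).
  destruct (separation hZF (P := fun U => exists n, n ∈ w /\ R U n) tau) as [C HC];
    [definability|].
  destruct (HK C) as (D & HDC & HDf & HDK).
  - intros U HU. now apply HC in HU.
  - intros x Hx. apply NNPP. intro Hx'. apply Hno. exists x. split; [trivial|].
    intros n U Hn HU HxU. apply NNPP. intro Hy. apply Hx'. exists U.
    split; [|trivial]. apply HC. split; [trivial|]. exists n. split; [trivial|].
    intros y S i HyU HyS HS Hi. apply NNPP. intro Hin. apply Hy.
    now exists y, S, i.
  - destruct (finite_bound hZF Hw HDf HR) as (N & HN & HDN).
    + intros U n m Hn Hm HUn Hnm y S i HyU HyS HS Hi.
      apply (nat_transitive hZF Hw Hm Hnm). now apply (HUn y S).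
    + intros U HU. apply HDC in HU. now apply HC in HU.
    + destruct (Hunb N HN) as (S & i & HS & Hi & HiN). apply HiN.
      destruct (HF S HS) as [HSK [y Hy]].
      destruct (HDK y (HSK y Hy)) as (U & HU & HyU).
      now apply (HDN U HU y S).
Qed.

Lemma CPCAC_of_Frechet_Urysohn :
  first_countable X tau -> Hausdorff X tau ->
  Frechet_Urysohn X tau -> CPCAC X tau.
Proof.
  intros hfc hT2 hFU K HK _ F [HFi HFc] HF.
  destruct (countable_numbering hZF Hw HFc) as (h & Hh1 & Hh2 & Hh3 & Hh4).
  assert (Hbounded : forall G N, N ∈ w -> G ⊆ F ->
    (forall S, S ∈ G -> exists i, i ∈ N /\ maps_to h S i) -> finite G).
  { intros G N HN HG. apply (finite_of_injection hZF Hw HN); [definability|].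
    intros S S' i _ _. apply Hh3. }
  assert (Hbound : forall G, finite G -> G ⊆ F -> exists N, N ∈ w /\
    forall S, S ∈ G -> exists i, i ∈ N /\ maps_to h S i).
  { intros G HG HGF.
    apply (finite_bound hZF Hw (R := fun S n => exists i, i ∈ n /\ maps_to h S i) HG).
    - definability.
    - intros S n m Hn Hm (i & Hi & HSi) Hnm. exists i. split; [|trivial].
      apply (nat_transitive hZF Hw Hm Hnm Hi).
    - intros S HS. destruct (Hh1 S (HGF S HS)) as (i & Hi & HSi).
      destruct (succ_exists hZF i) as [s Hs]. exists s.
      split; [now apply (succ_in_omega hZF Hw Hi)|]. exists i.
      split; [apply Hs; now right|trivial]. }
  assert (Hunb : forall n, n ∈ w -> exists S i, S ∈ F /\ maps_to h S i /\ ~ i ∈ n).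
  { intros n Hn. apply NNPP. intro Hno. apply HFi.
    apply (Hbounded F n Hn); [now intros S HS|].
    intros S HS. destruct (Hh1 S HS) as (i & Hi & HSi). exists i.
    split; [|trivial]. apply NNPP. intro Hin. apply Hno. now exists S, i. }
  destruct (compact_cluster_point HK HF Hunb) as (x & HxK & Hx).
  assert (HKX : K ⊆ X) by exact (proj1 HK).
  destruct (separation hZF (P := fun S => x ∈ S) F) as [G0 HG0]; [definability|].
  destruct (classic (finite G0)) as [HG0f|HG0i].
  2: { (* Infinitely many members contain x, which can be chosen for them all. *)
    exists G0. split; [intros S HS; now apply HG0 in HS|]. split; [exact HG0i|].
    destruct (@function_exists _ hZF (fun S y => y = x) G0 K) as (c & Hc & Hcx).
    - definability.
    - intros S _. now exists x.
    - congruence.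
    - exists c. split; [now exists K|]. intros S y Hy. apply Hcx in Hy.
      destruct Hy as [HS ->]. now apply HG0 in HS. }
  destruct (Hbound G0 HG0f) as (N0 & HN0 & HG0N);
    [intros S HS; now apply HG0 in HS|].
  assert (HxX : x ∈ X) by auto.
  destruct (local_base_exists hfc HxX) as [E HE].
  assert (HFX : forall S y, S ∈ F -> y ∈ S -> y ∈ X).
  { intros S y HS Hy. apply HKX. now apply (HF S HS). }
  assert (Hsep : forall S y, S ∈ F -> y ∈ S -> ~ x ∈ S ->
    exists n, n ∈ w /\ ~ maps_to E n y).
  { intros S y HS Hy HxS. apply (local_base_separates hT2 HE); eauto.
    intros ->. contradiction. }
  (* Q n S: among the members of F that omit x and meet the n-th neighbourhood,
     S is the first whose number is not below n. *)
  pose (Q0 := fun n i => exists S, S ∈ F /\ maps_to h S i /\ ~ i ∈ n /\ ~ x ∈ S /\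
    exists y, y ∈ S /\ maps_to E n y).
  pose (Q := fun n S => exists i, i ∈ w /\ Q0 n i /\ maps_to h S i /\
    forall j, j ∈ i -> ~ Q0 n j).
  assert (HQfun : forall n S S', Q n S -> Q n S' -> S = S').
  { intros n S S' (i & Hi & Hq & HS & Hmin) (i' & Hi' & Hq' & HS' & Hmin').
    destruct (nat_trichotomy hZF Hw Hi Hi') as [H|[H|H]].
    - now apply Hmin in H.
    - subst i'. apply (Hh3 S S' i HS HS').
    - now apply Hmin' in H. }
  assert (HQprop : forall n S, Q n S -> S ∈ F /\ ~ x ∈ S /\
    (exists y, y ∈ S /\ maps_to E n y) /\ exists i, maps_to h S i /\ ~ i ∈ n).
  { intros n S (i & Hi & (S' & HS' & HSi' & Hin & HxS & Hy) & HSi & _).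
    rewrite (Hh3 S S' i HSi HSi'). repeat split; trivial. now exists i. }
  assert (HQex : forall n, n ∈ w -> exists S, Q n S).
  { intros n Hn.
    destruct (omega_least hZF (w := w) (P := fun i => Q0 n i))
      as (i & Hi & Hq & Hmin).
    - unfold Q0. definability.
    - destruct (nat_upper_bound hZF Hw Hn HN0) as (m & Hm & Hnm & HN0m).
      destruct (proj1 HE n Hn) as (U & HU & HUE).
      destruct (Hx m U Hm HU) as (y & S & i & HyU & HyS & HS & HSi & Him).
      { apply HUE. now apply HE. }
      exists i. split; [now apply (Hh2 S)|]. exists S.
      split; [trivial|]. split; [trivial|]. split; [|split].
      + intro H. apply Him. apply (nat_transitive hZF Hw Hm Hnm H).
      + intro H. destruct (HG0N S) as (i' & Hi' & HSi'); [now apply HG0|].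
        rewrite (Hh4 S i i' HSi HSi') in Him. apply Him.
        apply (nat_transitive hZF Hw Hm HN0m Hi').
      + exists y. split; [trivial|]. now apply HUE.
    - destruct Hq as (S & HS & HSi & Hq). exists S, i. split; [trivial|].
      split; [now exists S|]. split; [trivial|]. intros j Hj.
      apply Hmin; trivial. apply (omega_transitive hZF Hw Hi Hj). }
  (* The points of the selected member inside the n-th neighbourhood that are
     farthest from x: they lie in a basic neighbourhood of x only if all the
     points of that trace do. *)
  pose (C := fun n y => exists S, Q n S /\ y ∈ S /\ maps_to E n y /\
    forall j, j ∈ w -> maps_to E j y -> forall z, z ∈ S -> maps_to E n z -> maps_to E j z).
  assert (HCex : forall n, n ∈ w -> exists y, C n y).
  { intros n Hn. destruct (HQex n Hn) as [S HQ].
    destruct (HQprop n S HQ) as (HS & HxS & (y & HyS & Hyn) & _).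
    destruct (Hsep S y HS HyS HxS) as (j & Hj & Hyj).
    destruct (omega_least hZF (w := w)
      (P := fun j => exists z, z ∈ S /\ maps_to E n z /\ ~ maps_to E j z))
      as (k & Hk & (z & HzS & Hzn & Hzk) & Hmin).
    - definability.
    - exists j. split; [trivial|]. now exists y.
    - exists z, S. split; [trivial|]. split; [trivial|]. split; [trivial|].
      intros i Hi Hzi u Hu Hun. apply NNPP. intro Hui. apply (Hmin i Hi).
      + apply NNPP. intro Hik. apply Hzk.
        apply (local_base_le HE Hk Hi); trivial.
        now apply (nat_not_mem hZF Hw).
      + now exists u. }
  assert (HCaway : forall n, n ∈ w -> exists j, j ∈ w /\
    forall y, C n y -> ~ maps_to E j y).
  { intros n Hn. destruct (HCex n Hn) as (y0 & S & HQ & Hy0S & Hy0n & _).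
    destruct (HQprop n S HQ) as (HS & HxS & _).
    destruct (Hsep S y0 HS Hy0S HxS) as (j & Hj & Hyj).
    exists j. split; [trivial|]. intros y (S' & HQ' & _ & _ & Hfar) Hy.
    rewrite (HQfun n S' S HQ' HQ) in Hfar. apply Hyj. now apply (Hfar j Hj Hy). }
  assert (HCX : forall n y, C n y -> y ∈ X).
  { intros n y (S & HQ & HyS & _). apply HQprop in HQ. now apply (HFX S). }
  destruct (separation hZF (P := fun y => exists n, n ∈ w /\ C n y) X) as [A HA].
  { unfold C, Q, Q0. definability. }
  destruct (hFU A x) as (w' & f & Hw' & Hf & Hconv).
  - intros y Hy. now apply HA in Hy.
  - apply in_closure_intro; [trivial|]. intros U HU HxU.
    destruct (proj2 (proj2 (proj2 HE)) U HU HxU) as (n & Hn & HnU).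
    destruct (HCex n Hn) as [y Hy]. exists y. split.
    + apply HnU. now destruct Hy as (S & _ & _ & H & _).
    + apply HA. split; [now apply (HCX n)|]. now exists n.
  - rewrite (omega_unique hZF Hw' Hw) in *. clear w' Hw'.
    destruct (separation hZF (P := fun S => exists i y, maps_to f i y /\ y ∈ S) F)
      as [G HG]; [definability|].
    assert (HGF : G ⊆ F) by (intros S HS; now apply HG in HS).
    exists G. split; [trivial|]. split.
    + intro HGf. destruct (Hbound G HGf HGF) as (N & HN & HGN).
      (* The sequence eventually leaves the first N of the pieces C n, each of
         which stays away from x. *)
      destruct (@finite_bound _ hZF w Hw N (fun n j => forall y, C n y -> ~ maps_to E j y))
        as (J & HJ & HNJ).
      * now apply (nat_finite hZF Hw).
      * unfold C, Q, Q0. definability.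
      * intros n i j Hi Hj Hni Hij y Hy Hyj. apply (Hni y Hy).
        apply (local_base_le HE Hi Hj); auto.
      * intros n Hn. apply HCaway. apply (omega_transitive hZF Hw HN Hn).
      * destruct (proj1 HE J HJ) as (U & HU & HUE).
        destruct (Hconv U HU) as (m & Hm & HmU).
        { apply HUE. now apply HE. }
        destruct (function_total Hf Hm) as [y Hy].
        assert (HyU : y ∈ U) by (apply (HmU m); auto).
        destruct (function_values hZF Hf Hy) as [_ HyA]. apply HA in HyA.
        destruct HyA as (_ & n & Hn & HCn).
        assert (HnN : ~ n ∈ N).
        { intro H. apply (HNJ n H y HCn). now apply HUE. }
        destruct HCn as (S & HQ & HyS & _).
        destruct (HQprop n S HQ) as (HS & _ & _ & i & HSi & Hin).
        destruct (HGN S) as (i' & Hi' & HSi').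
        { apply HG. split; [trivial|]. now exists m, y. }
        rewrite (Hh4 S i i' HSi HSi') in Hin. apply Hin.
        destruct (nat_not_mem hZF Hw HN Hn HnN) as [H| ->]; [|trivial].
        apply (nat_transitive hZF Hw Hn H Hi').
    + (* Choose the first term of the sequence that lies in the given set. *)
      destruct (@function_exists _ hZF (fun S y => exists i, i ∈ w /\ maps_to f i y /\
        y ∈ S /\ forall j, j ∈ i -> forall z, maps_to f j z -> ~ z ∈ S) G A)
        as (c & Hc & HcR).
      * definability.
      * intros S HS. apply HG in HS. destruct HS as (_ & HS).
        destruct (omega_least hZF (w := w)
          (P := fun i => exists y, maps_to f i y /\ y ∈ S))
          as (i & Hi & (y & Hy & HyS) & Hmin).
        -- definability.
        -- destruct HS as (i & y & Hy & HyS). exists i.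
           split; [|now exists y]. apply (function_values hZF Hf Hy).
        -- exists y. split; [apply (function_values hZF Hf Hy)|].
           exists i. split; [trivial|]. split; [trivial|]. split; [trivial|].
           intros j Hj z Hz HzS. apply (Hmin j); trivial.
           ++ apply (omega_transitive hZF Hw Hi Hj).
           ++ now exists z.
      * intros S y y' _ (i & Hi & Hy & HyS & Hmin) (i' & Hi' & Hy' & HyS' & Hmin').
        destruct (nat_trichotomy hZF Hw Hi Hi') as [H|[H|H]].
        -- now apply (Hmin i' H y') in Hy'.
        -- subst i'. apply (function_unique hZF Hf Hy Hy').
        -- now apply (Hmin' i H y) in Hy.
      * exists c. split; [now exists A|]. intros S y Hy. apply HcR in Hy.
        now destruct Hy as (_ & i & _ & _ & HyS & _).
Qed.

(** * Subspaces that are k-spaces *)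

Lemma subspace_Hausdorff (Y sigma : M) : Hausdorff X tau -> Y ⊆ X ->
  is_subspace_topology tau Y sigma -> Hausdorff Y sigma.
Proof.
  intros hT2 HY Hs x y Hx Hy Hxy.
  destruct (hT2 x y (HY x Hx) (HY y Hy) Hxy) as (U & V & HU & HV & HxU & HyV & Hd).
  destruct (separation hZF (P := fun z => z ∈ Y) U) as [U' HU']; [definability|].
  destruct (separation hZF (P := fun z => z ∈ Y) V) as [V' HV']; [definability|].
  exists U', V'. split; [|split; [|split; [|split]]].
  - apply Hs. now exists U.
  - apply Hs. now exists V.
  - now apply HU'.
  - now apply HV'.
  - intros z [H1 H2]. apply HU' in H1. apply HV' in H2. apply (Hd z). tauto.
Qed.

Lemma convergent_sequence_compact (Y sigma A y f K : M) :
  is_subspace_topology tau Y sigma -> A ⊆ Y -> y ∈ Y ->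
  is_function f w A -> converges_to tau w f y ->
  (forall z, z ∈ K <-> z = y \/ exists i, maps_to f i z) ->
  is_compact Y sigma K.
Proof.
  intros Hs HA Hy Hf Hconv HK.
  assert (HfA : forall i z, maps_to f i z -> i ∈ w /\ z ∈ A)
    by (intros i z; apply (function_values hZF Hf)).
  split.
  { intros z Hz. apply HK in Hz. destruct Hz as [-> | [i Hi]]; [trivial|].
    apply HA. now apply (HfA i). }
  intros C HC HCK.
  destruct (HCK y) as (U0 & HU0 & HyU0); [apply HK; now left|].
  destruct (proj1 (Hs U0) (HC U0 HU0)) as (O & HO & HU0O).
  destruct (Hconv O HO) as (N & HN & HNO); [now apply HU0O|].
  destruct (finite_collection hZF Hw (A := N) (C := C)
    (R := fun i U => forall z, maps_to f i z -> z ∈ U)) as (D & HDC & HDf & HDN).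
  - now apply (nat_finite hZF Hw).
  - definability.
  - intros i Hi. apply (omega_transitive hZF Hw HN) in Hi.
    destruct (function_total Hf Hi) as [z Hz].
    destruct (HCK z) as (U & HU & HzU); [apply HK; right; now exists i|].
    exists U. split; [trivial|]. intros z' Hz'.
    now rewrite (function_unique hZF Hf Hz' Hz).
  - destruct (insert_exists hZF D U0) as [D' HD']. exists D'. split; [|split].
    + intros U HU. apply HD' in HU. destruct HU as [HU| ->]; auto.
    + apply (finite_insert hZF Hw HDf HD').
    + assert (HU0D : U0 ∈ D') by (apply HD'; now right).
      intros z Hz. apply HK in Hz. destruct Hz as [-> | [i Hi]]; [now exists U0|].
      destruct (classic (i ∈ N)) as [HiN|HiN].
      * destruct (HDN i HiN) as (U & HU & HUz). exists U.
        split; [apply HD'; now left|auto].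
      * exists U0. split; [trivial|]. destruct (HfA i z Hi) as [Hiw HzA].
        apply HU0O. split; [|now apply HA].
        apply (HNO i); trivial. now apply (nat_not_mem hZF Hw).
Qed.

Lemma subspaces_k_of_Frechet_Urysohn :
  Hausdorff X tau -> Frechet_Urysohn X tau -> every_subspace_is_k_space X tau.
Proof.
  intros hT2 hFU Y sigma HY Hs. split; [now apply subspace_Hausdorff|].
  intros A HA Hk. split; [trivial|].
  destruct (diff_exists Y A) as [U HU]. exists U. split; [trivial|].
  destruct (separation hZF (P := fun z => exists O, O ∈ tau /\ z ∈ O /\
    forall u, u ∈ O -> ~ u ∈ A) X) as [W HW]; [definability|].
  apply Hs. exists W. split.
  - apply open_of_local. intros z Hz. apply HW in Hz.
    destruct Hz as (_ & O & HO & HzO & HOA). exists O.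
    split; [trivial|]. split; [trivial|]. intros u Hu. apply HW.
    split; [now apply (open_subset HO)|]. now exists O.
  - intro y. rewrite (HU y), HW. split.
    2: { intros [(_ & O & _ & HyO & HOA) Hy]. split; [trivial|]. now apply HOA. }
    intros [Hy HyA]. split; [|trivial]. split; [now apply HY|].
    apply NNPP. intro Hno.
    destruct (hFU A y) as (w' & f & Hw' & Hf & Hconv).
    + intros z Hz. auto.
    + apply in_closure_intro; [now apply HY|]. intros O HO HyO.
      apply NNPP. intro H. apply Hno. exists O. split; [trivial|].
      split; [trivial|]. intros u Hu HuA. apply H. now exists u.
    + rewrite (omega_unique hZF Hw' Hw) in *. clear w' Hw'.
      destruct (separation hZF (P := fun z => z = y \/ exists i, maps_to f i z) Y)
        as [K HK]; [definability|].
      assert (HK' : forall z, z ∈ K <-> z = y \/ exists i, maps_to f i z).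
      { intro z. rewrite HK. split; [tauto|]. intro H. split; [|trivial].
        destruct H as [-> | [i Hi]]; [trivial|].
        apply HA. apply (function_values hZF Hf Hi). }
      destruct (separation hZF (P := fun z => z ∈ K) A) as [B HB]; [definability|].
      destruct (Hk K B) as [_ (V & HV & HVs)]; trivial.
      { now apply (convergent_sequence_compact Hs HA Hy Hf). }
      apply Hs in HVs. destruct HVs as (O & HO & HVO).
      assert (HyV : y ∈ V).
      { apply HV. split; [trivial|]. intro H. now apply HB in H. }
      destruct (Hconv O HO) as (n & Hn & HnO); [now apply HVO|].
      destruct (function_total Hf Hn) as [z Hz].
      assert (HzA : z ∈ A) by apply (function_values hZF Hf Hz).
      assert (HzV : z ∈ V).
      { apply HVO. split; [apply (HnO n); auto|now apply HA]. }
      apply HV in HzV. apply (proj2 HzV). apply HB. split; [trivial|].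
      apply HK'. right. now exists n.
Qed.

Lemma subspace_topology_exists (Y : M) : exists sigma, is_subspace_topology tau Y sigma.
Proof.
  destruct (zf_power_set hZF Y) as [PY HPY].
  destruct (separation hZF (P := fun V => exists U, U ∈ tau /\ is_inter V U Y) PY)
    as [sigma Hs]; [definability|].
  exists sigma. intro V. rewrite Hs. split; [tauto|]. intro H.
  split; [|trivial]. destruct H as (U & _ & HV). apply HPY.
  intros z Hz. now apply HV in Hz.
Qed.

(** The traces of a cover of [K] cover it in the subspace; going back from the
    finitely many traces to sets of the cover is a finite choice. *)
Lemma subspace_compact (Y sigma K : M) : Y ⊆ X ->
  is_subspace_topology tau Y sigma -> is_compact Y sigma K -> is_compact X tau K.
Proof.
  intros HY Hs [HKY HK]. split; [intros z Hz; auto|]. intros C HC HCK.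
  destruct (separation hZF (P := fun V => exists U, U ∈ C /\ is_inter V U Y) sigma)
    as [C' HC']; [definability|].
  destruct (HK C') as (D & HDC & HDf & HDK).
  - intros V HV. now apply HC' in HV.
  - intros z Hz. destruct (HCK z Hz) as (U & HU & HzU).
    destruct (separation hZF (P := fun u => u ∈ Y) U) as [V HV]; [definability|].
    exists V. split.
    + apply HC'. split; [apply Hs; exists U; auto | now exists U].
    + apply HV. auto.
  - destruct (finite_collection hZF Hw (A := D) (C := C)
      (R := fun V U => is_inter V U Y)) as (D' & HDC' & HDf' & HD'); trivial.
    + definability.
    + intros V HV. apply HDC in HV. now apply HC' in HV.
    + exists D'. split; [trivial|]. split; [trivial|].
      intros z Hz. destruct (HDK z Hz) as (V & HV & HzV).
      destruct (HD' V HV) as (U & HU & HVU). exists U. split; [trivial|].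
      now apply HVU in HzV.
Qed.

(** The points of the sequence are taken from the compact sets left when a small
    neighbourhood of [x] is removed from [K] intersected with the closure of a
    larger one; regularity makes these closures shrink to [x]. *)
Lemma Frechet_Urysohn_of_subspaces_k :
  first_countable X tau -> Hausdorff X tau -> K_Loeb X tau -> regular X tau ->
  every_subspace_is_k_space X tau -> Frechet_Urysohn X tau.
Proof.
  intros hfc hT2 (F & c & HF & (Cod & Hc) & Hcin) hreg hk A x HA HxA. exists w.
  cut (exists f, is_function f w A /\ converges_to tau w f x).
  { intros [f Hf]. now exists f. }
  destruct (classic (x ∈ A)) as [HxA'|HxA']; [now apply constant_sequence|].
  assert (HxX : x ∈ X) by exact (proj1 HxA).
  destruct (insert_exists hZF A x) as [Y HY].
  assert (HYX : Y ⊆ X).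
  { intros z Hz. apply HY in Hz. destruct Hz as [Hz| ->]; auto. }
  destruct (subspace_topology_exists Y) as [sigma Hs].
  assert (HK : exists K B, is_compact Y sigma K /\ is_inter B A K /\
    ~ is_closed Y sigma B).
  { apply NNPP. intro Hno. destruct (hk Y sigma HYX Hs) as [_ HkY].
    destruct (HkY A) as [_ (U & HU & HUs)].
    - intros z Hz. apply HY. now left.
    - intros K B HK HB. apply NNPP. intro H. apply Hno. now exists K, B.
    - apply Hs in HUs. destruct HUs as (O & HO & HUO).
      assert (HxO : x ∈ O).
      { apply (HUO x). apply HU. split; [apply HY; now right|trivial]. }
      destruct (closure_meets HA HxA HO HxO) as (y & HyO & HyA).
      assert (HyU : y ∈ U).
      { apply HUO. split; [trivial|]. apply HY. now left. }
      apply HU in HyU. tauto. }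
  destruct HK as (K & B & HKY & HB & HBc).
  assert (HK : is_compact X tau K) by apply (subspace_compact HYX Hs HKY).
  assert (HBX : B ⊆ X) by (intros z Hz; apply HB in Hz; apply HA; tauto).
  assert (HxB : in_closure X tau B x).
  { apply in_closure_intro; [trivial|]. intros U HU HxU.
    apply NNPP. intro Hno. apply HBc. split.
    - intros z Hz. apply HB in Hz. apply HY. now left.
    - destruct (diff_exists Y B) as [V HV]. exists V. split; [trivial|].
      destruct (separation hZF (P := fun z => z ∈ U \/ ~ z ∈ K) X) as [W HW];
        [definability|].
      apply Hs. exists W. split.
      + apply open_of_local. intros z Hz. apply HW in Hz.
        destruct Hz as [HzX [HzU|HzK]].
        * exists U. split; [trivial|]. split; [trivial|]. intros u Hu.
          apply HW. split; [now apply (open_subset HU)|now left].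
        * destruct (compact_separation hfc hT2 HK HzX HzK) as (O & HO & HzO & HOK).
          exists O. split; [trivial|]. split; [trivial|]. intros u Hu.
          apply HW. split; [now apply (open_subset HO)|right; auto].
      + intro z. rewrite (HV z), HW. split.
        * intros [Hz HzB]. split; [|trivial]. split; [auto|].
          destruct (classic (z ∈ K)) as [HzK|HzK]; [left|now right].
          apply HY in Hz. destruct Hz as [Hz| ->]; [|trivial].
          contradict HzB. apply HB. now split.
        * intros [[_ HzW] HzY]. split; [trivial|]. intro HzB.
          destruct HzW as [HzU|HzK].
          -- apply Hno. now exists z.
          -- apply HzK. now apply HB in HzB. }
  destruct (local_base_exists hfc HxX) as [E HE].
  (* L n m S: S is the part of K in the closure of the n-th neighbourhood and
     outside the m-th one. *)
  pose (cl := fun n z => forall O, O ∈ tau -> z ∈ O -> exists u, u ∈ O /\ maps_to E n u).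
  pose (L := fun n m S => forall z, z ∈ S <-> z ∈ K /\ cl n z /\ ~ maps_to E m z).
  assert (HLuniq : forall n m S S', L n m S -> L n m S' -> S = S').
  { intros n m S S' H H'. apply (zf_extensionality hZF). intro z.
    now rewrite (H z), (H' z). }
  assert (HLc : forall n m S, n ∈ w -> m ∈ w -> L n m S -> is_compact X tau S).
  { intros n m S Hn Hm HS. apply (compact_of_relatively_closed HK).
    - intros z Hz. now apply HS in Hz.
    - intros z Hz HzS. destruct (classic (maps_to E m z)) as [Hzm|Hzm].
      + destruct (proj1 HE m Hm) as (O & HO & HOm). exists O.
        split; [trivial|]. split; [now apply HOm|]. intros y Hy HyS.
        apply HOm in Hy. apply HS in HyS. tauto.
      + assert (Hcl : ~ cl n z) by (intro H; apply HzS; now apply HS).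
        apply NNPP. intro Hno. apply Hcl. intros O HO HzO.
        apply NNPP. intro Hu. apply Hno. exists O. split; [trivial|].
        split; [trivial|]. intros y Hy HyS. apply HS in HyS.
        destruct HyS as (_ & Hycl & _). apply Hu. now apply Hycl. }
  pose (Q := fun n m S => m ∈ w /\ L n m S /\ nonempty S /\
    forall j, j ∈ m -> forall S', L n j S' -> is_empty S').
  assert (HLex : forall n m, exists S, L n m S).
  { intros n m. apply (separation hZF (P := fun z => cl n z /\ ~ maps_to E m z)).
    unfold cl. definability. }
  assert (HQex : forall n, n ∈ w -> exists m S, Q n m S).
  { intros n Hn. destruct (closure_meets_base HBX HxB HE Hn) as (y & Hyn & HyB).
    destruct (local_base_separates hT2 HE HxX (HBX y HyB)) as (j & Hj & Hyj).
    { intros ->. apply HB in HyB. tauto. }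
    destruct (omega_least hZF (w := w) (P := fun m => exists S, L n m S /\ nonempty S))
      as (m & Hm & (S & HS & HSne) & Hmin).
    - unfold L, cl. definability.
    - exists j. split; [trivial|]. destruct (HLex n j) as [S HS]. exists S.
      split; [trivial|]. exists y. apply HS. split; [now apply HB in HyB|].
      split; [|trivial]. intros O HO HyO. now exists y.
    - exists m, S. split; [trivial|]. split; [trivial|]. split; [trivial|].
      intros i Hi S' HS' z Hz. apply (Hmin i); trivial.
      + apply (omega_transitive hZF Hw Hm Hi).
      + exists S'. split; [trivial|]. now exists z. }
  assert (HQfun : forall n m S m' S', Q n m S -> Q n m' S' -> S = S').
  { intros n m S m' S' (Hm & HS & [z Hz] & Hmin) (Hm' & HS' & [z' Hz'] & Hmin').
    destruct (nat_trichotomy hZF Hw Hm Hm') as [H|[H|H]].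
    - now apply (Hmin m' H S' HS') in Hz'.
    - subst m'. apply (HLuniq n m S S' HS HS').
    - now apply (Hmin' m H S HS) in Hz. }
  destruct (@function_exists _ hZF (fun n y => exists m S, Q n m S /\ maps_to c S y) w A)
    as (f & Hf & HfR).
  - unfold Q, L, cl. definability.
  - intros n Hn. destruct (HQex n Hn) as (m & S & HQ).
    assert (HSF : S ∈ F).
    { apply HF. destruct HQ as (Hm & HS & HSne & _).
      split; [now apply (HLc n m)|trivial]. }
    destruct (function_total Hc HSF) as [y Hy].
    exists y. split; [|now exists m, S].
    destruct HQ as (Hm & HS & _ & _).
    apply Hcin in Hy. apply HS in Hy. destruct Hy as (HyK & _ & Hym).
    apply (proj1 HKY), HY in HyK. destruct HyK as [HyA| ->]; [trivial|].
    contradict Hym. now apply HE.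
  - intros n y y' _ (m & S & HQ & Hy) (m' & S' & HQ' & Hy').
    rewrite (HQfun n m' S' m S HQ' HQ) in Hy'.
    apply (function_unique hZF Hc Hy Hy').
  - exists f. split; [trivial|]. intros U HU HxU.
    destruct (diff_exists X U) as [C HC].
    destruct (hreg x C) as (O & V & HO & HV & HxO & HCV & Hdis).
    + trivial.
    + split; [intros z Hz; now apply HC in Hz|]. exists U. split; [|trivial].
      intro z. rewrite (HC z). split.
      * intro Hz. split; [now apply (open_subset HU)|tauto].
      * intros [Hz H]. apply NNPP. tauto.
    + intro H. apply HC in H. tauto.
    + destruct (proj2 (proj2 (proj2 HE)) O HO HxO) as (n & Hn & HnO).
      exists n. split; [trivial|]. intros m y Hm Hnm Hy.
      apply HfR in Hy. destruct Hy as (_ & k & S & (_ & HS & _) & Hy).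
      apply Hcin in Hy. apply HS in Hy. destruct Hy as (HyK & Hcl & _).
      apply NNPP. intro HyU.
      destruct (Hcl V HV) as (u & HuV & Hum).
      { apply HCV. apply HC. split; [now apply (proj1 HK)|trivial]. }
      apply (Hdis u). split; [|trivial]. apply HnO.
      now apply (local_base_le HE Hn Hm Hnm).
Qed.

End Spaces.

Theorem theorem7p7 (M : set_structure) (hZF : ZF M) (X tau : M)
  (htop : is_topology X tau)
  (hfc : first_countable X tau)
  (hT2 : Hausdorff X tau)
  (hcl : forall A x : M, subset A X -> in_closure X tau A x ->
     exists K B : M,
       is_compact X tau K /\ is_inter B A K /\ in_closure X tau B x) :
  (Frechet_Urysohn X tau <-> CPCAC X tau) /\
  (K_Loeb X tau -> regular X tau ->
     (every_subspace_is_k_space X tau <-> Frechet_Urysohn X tau) /\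
     (Frechet_Urysohn X tau <-> CPCAC X tau)).
Proof.
  destruct (omega_exists hZF) as [w Hw].
  assert (H : Frechet_Urysohn X tau <-> CPCAC X tau).
  { split.
    - now apply (CPCAC_of_Frechet_Urysohn hZF htop Hw).
    - now apply (Frechet_Urysohn_of_CPCAC hZF htop Hw). }
  split; [exact H|]. intros hLoeb hreg. split; [|exact H]. split.
  - now apply (Frechet_Urysohn_of_subspaces_k hZF htop Hw).
  - now apply (subspaces_k_of_Frechet_Urysohn hZF htop Hw).
Qed.
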